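(* Let $(X,\|\cdot\|)$ be a uniformly smooth Banach space. Then each equivalent norm on $X$ can be approximated uniformly on bounded sets by uniformly smooth norms induced by quasihyperbolic balls: for every equivalent norm $|||\cdot|||$ on $X$, every bounded set $S\subset X$ and every $\varepsilon>0$ there are a convex, bounded, symmetric domain $\Omega\subset X$ and $r>0$ such that the norm $M_{\mathbf B_k(0,r)}$, where $k=k_\Omega$, is a uniformly smooth equivalent norm on $X$ and $\sup_{x\in S}\big|M_{\mathbf B_k(0,r)}(x)-|||x|||\big|\le\varepsilon$. Moreover, if the modulus of smoothness of $\|\cdot\|$ has power type $p$ with $1<p\le2$, then the approximating norms $M_{\mathbf B_k(0,r)}$ have modulus of smoothness of power type $q$ for every $q<(p+1)/2$.
   Context: Banach spaces are real. A domain $\Omega\subset X$ is an open path-connected subset with non-empty boundary $\partial\Omega$; symmetric means $-\Omega=\Omega$. Write $d(z,\partial\Omega)$ for the $\|\cdot\|$-distance from $z$ to $\partial\Omega$. The quasihyperbolic metric on $\Omega$ (taken with respect to $\|\cdot\|$) is $$k_\Omega(x,y)=\inf_\gamma\int_\gamma\frac{\|dz\|}{d(z,\partial\Omega)},$$ the infimum being over all rectifiable curves $\gamma$ in $\Omega$ joining $x$ and $y$. $\mathbf B_k(0,r)=\{x\in\Omega:k(0,x)\le r\}$. For $B\subset X$, the Minkowski functional is $M_B(x)=\inf\{\lambda>0: x\in\lambda B\}$; for $\Omega$ convex, bounded and symmetric, $M_{\mathbf B_k(0,r)}$ is an equivalent norm on $X$, called the norm induced by the quasihyperbolic ball. The modulus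 of smoothness of a norm $\|\cdot\|$ is $\mu_{\|\cdot\|}(\tau)=\sup\{(\|y+h\|+\|y-h\|)/2-1:\|y\|=1,\ \|h\|=\tau\}$. The norm is uniformly smooth if $\mu_{\|\cdot\|}(\tau)/\tau\to0$ as $\tau\to0^+$. The modulus of smoothness has power type $p$ if there is a constant $K$ with $\mu_{\|\cdot\|}(\tau)\le K\tau^p$ for all sufficiently small $\tau>0$. *)

(* Defs.v *)
From HB Require Import structures.
From mathcomp Require Import all_boot all_order all_algebra.
From mathcomp Require Import all_classical all_reals all_analysis.

Set Implicit Arguments.
Unset Strict Implicit.
Unset Printing Implicit Defensive.

Import Order.TTheory GRing.Theory Num.Theory.
Import numFieldNormedType.Exports.

Local Open Scope classical_set_scope.
Local Open Scope ring_scope.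

Section Norms.
Context {R : realType} {X : normedModType R}.
Implicit Types (N : X -> R) (B : set X).

Definition is_norm N :=
  [/\ forall x y, N (x + y) <= N x + N y,
      forall (a : R) x, N (a *: x) = `|a| * N x
    & forall x, N x = 0 -> x = 0].

Definition equivalent_norm N :=
  is_norm N /\
  exists c C : R, [/\ 0 < c, 0 < C & forall x, c * `|x| <= N x <= C * `|x|].

(* For a norm N on a nonzero space and tau >= 0 the set below is nonempty and
   bounded by tau, so that the real-valued sup is the true supremum. *)
Definition modulus_of_smoothness N (tau : R) : R :=
  sup [set m | exists y h,
         [/\ N y = 1, N h = tau & m = (N (y + h) + N (y - h)) / 2 - 1]].

Definition uniformly_smooth N :=
  modulus_of_smoothness N tau / tau @[tau --> 0^'+] --> (0 : R).

Definition smoothness_power_type N (p : R) :=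
  exists K : R,
    \forall tau \near 0^'+, modulus_of_smoothness N tau <= K * tau `^ p.

Definition minkowski_functional B (x : X) : R :=
  inf [set l | 0 < l /\ [set l *: b | b in B] x].

End Norms.

Section QuasihyperbolicMetric.
Context {R : realType} {X : normedModType R}.
Implicit Types (Omega : set X) (gamma : R -> X) (x y z : X).

Definition boundary Omega : set X := closure Omega `\` interior Omega.

(* gamma is only relevant on [0, 1] *)
Definition curve_in Omega x y gamma :=
  [/\ {within `[0, 1], continuous gamma}, gamma 0 = x, gamma 1 = y
    & forall t, t \in `[0, 1] -> Omega (gamma t)].

Definition path_connected Omega :=
  forall x y, Omega x -> Omega y -> exists gamma, curve_in Omega x y gamma.

Definition domain Omega :=
  [/\ open Omega, path_connected Omega & boundary Omega !=set0].

Definition symmetric_set Omega := [set - x | x in Omega] = Omega.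

Definition boundary_distance Omega z : R :=
  inf [set `|z - w| | w in boundary Omega].

(* A partition 0 = t_0 < ... < t_n = 1 is represented, as in itv_partition, by
   the sequence s = [:: t_1; ...; t_n]. *)
Definition node (s : seq R) (i : nat) : R := nth 1 (0 :: s) i.

Definition rectifiable gamma :=
  has_ubound [set l | exists2 s, itv_partition 0 1 s &
    l = \sum_(0 <= i < size s) `|gamma (node s i.+1) - gamma (node s i)|].

(* I is the integral of rho(z) ||dz|| along gamma, as the limit, when the mesh
   goes to 0, of the Riemann-Stieltjes sums
   sum_i rho(gamma(xi_i)) ||gamma(t_(i+1)) - gamma(t_i)||.  It exists for every
   continuous rectifiable gamma along which rho is continuous. *)
Definition is_curve_integral (rho : X -> R) gamma (I : R) :=
  forall e : R, 0 < e -> exists2 d : R, 0 < d &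
    forall (s : seq R) (xi : nat -> R),
      itv_partition 0 1 s ->
      (forall i, (i < size s)%N -> node s i.+1 - node s i < d) ->
      (forall i, (i < size s)%N -> node s i <= xi i <= node s i.+1) ->
      `|\sum_(0 <= i < size s)
          rho (gamma (xi i)) * `|gamma (node s i.+1) - gamma (node s i)| - I|
        < e.

(* In an open path-connected set any two points are joined by a rectifiable
   curve, so that for x and y in a domain this is a genuine infimum. *)
Definition quasihyperbolic_metric Omega x y : R :=
  inf [set I | exists gamma,
         [/\ curve_in Omega x y gamma, rectifiable gamma
           & is_curve_integral (fun z => (boundary_distance Omega z)^-1)
               gamma I]].

Definition quasihyperbolic_ball Omega (r : R) : set X :=
  [set x | Omega x /\ quasihyperbolic_metric Omega 0 x <= r].

Definition quasihyperbolic_norm Omega (r : R) : X -> R :=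
  minkowski_functional (quasihyperbolic_ball Omega r).

End QuasihyperbolicMetric.

(* Main.v *)
Require Import Defs.
From HB Require Import structures.
From mathcomp Require Import all_boot all_order all_algebra.
From mathcomp Require Import all_classical all_reals all_analysis.
From mathcomp Require Import ring lra.

Set Implicit Arguments.
Unset Strict Implicit.
Unset Printing Implicit Defensive.

Import Order.TTheory GRing.Theory Num.Theory.
Import numFieldNormedType.Exports.

Local Open Scope classical_set_scope.
Local Open Scope ring_scope.

(** The domain is the open unit ball Omega of the given norm N and the radius r
is large. Along a segment from 0 to a point of (1 - e) Omega the distance to the
boundary is at least a constant times e, so such points are at quasihyperbolic
distance O(1/e) from 0; hence (1 - e) Omega is contained in the ball of radius
r = O(1/e), which is contained in Omega, and the induced norm lies between N and
N / (1 - e) ([qh_norm_approximation]).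

Write d for the distance to the boundary and k for the quasihyperbolic distance
to 0. Everything about k is deduced from discrete curves: chains 0 = z_0, ...,
z_n in which step i has norm at most a_i d(z_i). Such a chain gives
k(z_n) <= (1 + o(1)) sum a_i when the a_i are small, because its polygon has a
curve integral ([chain_metric_le]); conversely a point with k x < c is the end
of chains with all costs equal to dl and total cost at most c, for every small
dl ([curve_reachable]). As d is concave, chains with the same costs can be
combined convexly and scaled; so quasihyperbolic balls are convex, and
k(l x) <= l k(x) for 0 <= l <= 1.

Smoothness comes from a variation of the last part, of quasihyperbolic length s,
of an almost optimal chain ending at x: displacements growing linearly from 0 to
+h and to -h are added to its points. Uniform smoothness of the given norm
bounds the sum of the lengths of the two new chains up to an error
s mu(C |h| / s), where mu is the modulus of smoothness. The function 1 / d may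
fail to be smooth, but d is Lipschitz, and d is only perturbed along a piece of
length s, which costs an error O(s |h|) ([metric_variation]). Therefore the
modulus of the induced norm at tau is at most C s (mu(C tau / s) + tau) for every
admissible s ([qh_modulus_le]). A fixed small s gives uniform smoothness. If
mu(tau) = O(tau^p), the choice s = sqrt tau gives the exponent
min((p + 1) / 2, 3 / 2) = (p + 1) / 2. *)

(** * Second differences and the modulus of smoothness *)

Section NormSums.
Context {R : realType} {X : normedModType R}.
Implicit Types (u v w : X).

Lemma normrZ_ge0 (c : R) v : 0 <= c -> `|c *: v| = c * `|v|.
Proof. by move=> c0; rewrite normrZ ger0_norm. Qed.

(** The left-hand side is an even convex function of [l], so on [-1, 1] it is
largest at the end points. Applied to both vectors, this reduces second
differences over balls to second differences over spheres. *)
Lemma norm_sum_contract v w (l : R) : `|l| <= 1 ->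
  `|l *: v + w| + `|l *: v - w| <= `|v + w| + `|v - w|.
Proof.
rewrite ler_norml => /andP[l1 l2].
pose p : R := (1 + l) / 2; pose q : R := (1 - l) / 2.
have lE : l = p - q by rewrite /p /q; lra.
have oneE : 1 = p + q by rewrite /p /q; lra.
have eD (x y : X) : l *: x + y = p *: (x + y) - q *: (x - y).
  rewrite {1}lE -[in LHS](scale1r y) oneE scalerBl scalerDl scalerDr scalerBr.
  by rewrite opprB addrACA; congr (_ + _); exact: addrC.
have e1 := eD v w; have e2 := eD v (- w); rewrite opprK in e2.
have p0 : 0 <= p by rewrite /p; lra.
have q0 : 0 <= q by rewrite /q; lra.
have := ler_normB (p *: (v + w)) (q *: (v - w)).
have := ler_normB (p *: (v - w)) (q *: (v + w)).
rewrite -e1 -e2 !(normrZ_ge0 _ p0) !(normrZ_ge0 _ q0).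
by rewrite /p /q; lra.
Qed.

Lemma norm_sum_sym v w : `|v + w| + `|v - w| = `|w + v| + `|w - v|.
Proof. by rewrite [v + w]addrC [`|v - w|]distrC. Qed.

Lemma exists_norm1 : (exists x : X, x != 0) -> exists u : X, `|u| = 1.
Proof.
move=> [x x0]; exists (`|x|^-1 *: x).
by rewrite normrZ normfV normr_id mulVf// normr_eq0.
Qed.

Lemma exists_direction : (exists x : X, x != 0) ->
  forall v (r : R), `|v| <= r -> exists u l, [/\ `|u| = 1, `|l| <= 1 & v = l *: (r *: u)].
Proof.
move=> X0 v r vr; have [u u1] := exists_norm1 X0.
have [->|v0] := eqVneq v 0.
  by exists u, 0; rewrite normr0 scale0r; split.
have nv : 0 < `|v| by rewrite normr_gt0.
have r0 : 0 < r by exact: lt_le_trans vr.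
exists (`|v|^-1 *: v), (`|v| / r); split.
- by rewrite normrZ normfV normr_id mulVf// gt_eqF.
- by rewrite normrM normfV normr_id (gtr0_norm r0) ler_pdivrMr// mul1r.
- by rewrite !scalerA divfK ?gt_eqF// divff ?gt_eqF// scale1r.
Qed.

Lemma modulus_ub v w : `|v| = 1 ->
  `|v + w| + `|v - w| <= 2 * (1 + modulus_of_smoothness (fun x : X => `|x|) `|w|).
Proof.
move=> v1.
suff : (`|v + w| + `|v - w|) / 2 - 1 <= modulus_of_smoothness (fun x : X => `|x|) `|w|.
  by move=> ?; lra.
apply: ub_le_sup; last by exists v, w.
exists `|w| => _ [y [h [y1 h1 ->]]].
have := ler_normD y h; have := ler_normB y h; rewrite y1 h1; lra.
Qed.

(** By convexity in [v] and in [w] the worst case is a pair on the spheres, where the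
modulus applies. That [v] may be shorter than [r], even zero, is what allows
chains whose steps are not of maximal length to be varied. *)
Lemma norm_sum_modulus (X_neq0 : exists x : X, x != 0) v w (r theta : R) :
  0 <= r -> 0 <= theta -> `|v| <= r -> `|w| <= theta * r ->
  `|v + w| + `|v - w| <=
    2 * r * (1 + modulus_of_smoothness (fun x : X => `|x|) theta).
Proof.
move=> r0 th0 vr wr.
have [u [l [u1 l1 ->]]] := exists_direction X_neq0 vr.
have [u' [l' [u1' l1' ->]]] := exists_direction X_neq0 wr.
apply: (le_trans (norm_sum_contract _ _ l1)).
rewrite norm_sum_sym; apply: (le_trans (norm_sum_contract _ _ l1')).
rewrite norm_sum_sym [theta * r]mulrC -scalerA -scalerDr -scalerBr !normrZ ger0_norm//.
rewrite -mulrDr [2 * r]mulrC -mulrA ler_wpM2l//.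
apply: (le_trans (modulus_ub _ u1)).
by rewrite normrZ u1' mulr1 ger0_norm.
Qed.

End NormSums.

Section Modulus.
Context {R : realType} {X : normedModType R}.
Variable N : X -> R.
Hypothesis N_norm : is_norm N.

Lemma is_normN x : N (- x) = N x.
Proof.
by have [_ NZ _] := N_norm; rewrite -scaleN1r NZ normrN normr1 mul1r.
Qed.

Lemma is_norm_half x h : 2 * N x <= N (x + h) + N (x - h).
Proof.
have [ND NZ _] := N_norm; have := ND (x + h) (x - h).
rewrite addrACA subrr addr0 -mulr2n -scaler_nat NZ ger0_norm//.
Qed.

Lemma modulus_ge0 tau : 0 <= modulus_of_smoothness N tau.
Proof.
rewrite /modulus_of_smoothness; set E := [set _ | _].
have [[m Em]|/set0P/negP/negPn/eqP ->] := pselect (E !=set0); last by rewrite sup0.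
have m0 : 0 <= m.
  by case: Em => y [h [y1 _ ->]]; have := is_norm_half y h; rewrite y1; lra.
have [ubE|nub] := pselect (has_ubound E).
  by apply: (le_trans m0); exact: ub_le_sup.
by rewrite sup_out// => -[].
Qed.

Lemma modulus_le (tau e : R) : 0 <= e ->
  (forall y h, N y = 1 -> N h = tau -> N (y + h) + N (y - h) <= 2 + 2 * e) ->
  modulus_of_smoothness N tau <= e.
Proof.
move=> e0 H; rewrite /modulus_of_smoothness; set E := [set _ | _].
have [E0|/set0P/negP/negPn/eqP ->] := pselect (E !=set0); last by rewrite sup0.
apply: ge_sup => // _ [y [h [y1 h1 ->]]]; have := H _ _ y1 h1; lra.
Qed.

Lemma modulus_le_tau (tau : R) : 0 <= tau -> modulus_of_smoothness N tau <= tau.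
Proof.
move=> t0; apply: modulus_le => // y h y1 h1; have [ND _ _] := N_norm.
have := ND y h; have := ND y (- h); rewrite is_normN y1 h1; lra.
Qed.

End Modulus.

Lemma normr_is_norm {R : realType} {X : normedModType R} :
  is_norm (fun x : X => `|x|).
Proof.
split; [exact: ler_normD|exact: normrZ|by move=> x /eqP; rewrite normr_eq0 => /eqP].
Qed.

(** * The distance to the boundary *)

Section BoundaryDistance.
Context {R : realType} {X : normedModType R}.
Variable Omega : set X.
Implicit Types (x y z v w : X).

Local Notation d := (boundary_distance Omega).

Lemma boundary_distance_le z w : boundary Omega w -> d z <= `|z - w|.
Proof.
move=> bw; apply: ge_inf; last by exists w.
by exists 0 => _ [u _ <-].
Qed.

Lemma boundary_distance_ge z (r : R) : boundary Omega !=set0 ->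
  (forall w, boundary Omega w -> r <= `|z - w|) -> r <= d z.
Proof.
move=> [w bw] h; apply: lb_le_inf; first by exists `|z - w|, w.
by move=> _ [u bu <-]; exact: h.
Qed.

Lemma boundary_distance_sub x y : boundary Omega !=set0 -> d x - `|x - y| <= d y.
Proof.
move=> b0; apply: boundary_distance_ge => // w bw.
have := boundary_distance_le x bw; have := ler_distD y x w; lra.
Qed.

Lemma boundary_distance_lip x y : boundary Omega !=set0 -> `|d x - d y| <= `|x - y|.
Proof.
move=> b0; rewrite ler_norml; apply/andP; split.
  by have := boundary_distance_sub y x b0; rewrite distrC; lra.
by have := boundary_distance_sub x y b0; lra.
Qed.

Hypothesis Omega_open : open Omega.

Lemma open_ball_sub x : Omega x -> exists2 e : R, 0 < e & forall y, `|x - y| < e -> Omega y.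
Proof.
move=> Ox; have : nbhs x Omega by apply: open_nbhs_nbhs.
move=> /nbhs_ballP[e /= e0 h]; exists e => // y xy; apply: h.
by rewrite -ball_normE.
Qed.

Lemma boundary_notin w : boundary Omega w -> ~ Omega w.
Proof. by move=> [_ ni] Ow; apply: ni; apply: open_nbhs_nbhs. Qed.

Hypothesis boundary_neq0 : boundary Omega !=set0.

Lemma boundary_distance_ge_ball z (r : R) :
  (forall v, `|v| < r -> Omega (z + v)) -> r <= d z.
Proof.
move=> h; apply: boundary_distance_ge => // w bw.
rewrite leNgt; apply/negP => zw; apply: (boundary_notin bw).
by rewrite -[w](subrK z) addrC; apply: h; rewrite distrC.
Qed.

Lemma boundary_distance_gt0 z : Omega z -> 0 < d z.
Proof.
move=> /open_ball_sub[e e0 h]; apply: (lt_le_trans e0).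
apply: boundary_distance_ge_ball => v ve; apply: h.
by rewrite opprD addrA subrr add0r normrN.
Qed.

(** Otherwise the first parameter at which the segment from [z] to [z + v] leaves
Omega gives a boundary point at distance at most [`|v|] from [z]. *)
Lemma boundary_distance_step z v : Omega z -> `|v| < d z -> Omega (z + v).
Proof.
move=> Oz vd; apply: contrapT => nO.
pose F := [set t : R | 0 <= t <= 1 /\ ~ Omega (z + t *: v)].
have F1 : F 1 by split; [rewrite ler01 lexx|rewrite scale1r].
have infF : has_inf F by split; [exists 1|exists 0 => t [/andP[]]].
pose t0 := inf F.
have t01 : t0 <= 1 by apply: ge_inf => //; case: infF.
have t00 : 0 <= t0 by apply: lb_le_inf; [exists 1|move=> t [/andP[]]].
have dist s t : `|z + s *: v - (z + t *: v)| = `|s - t| * `|v|.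
  by rewrite opprD addrACA subrr add0r -scalerBl normrZ.
have v1 : 0 < `|v| + 1 by rewrite ltr_wpDl.
have close (e s t : R) : 0 < e -> `|s - t| < e / (`|v| + 1) ->
    `|z + s *: v - (z + t *: v)| < e.
  move=> e0; rewrite ltr_pdivlMr// dist; apply: le_lt_trans.
  by rewrite ler_wpM2l// lerDl.
have nO0 : ~ Omega (z + t0 *: v).
  move=> /open_ball_sub[e e0 h].
  have e1 : 0 < e / (`|v| + 1) by rewrite divr_gt0.
  have [t [tt nt] tlt] := inf_adherent e1 infF.
  have t0t : t0 <= t by apply: ge_inf => //; case: infF.
  apply: nt; apply: h; apply: close => //.
  by rewrite distrC ger0_norm ?subr_ge0// ltrBlDl.
have t0_gt0 : 0 < t0.
  rewrite lt_neqAle t00 andbT eq_sym; apply/eqP => t0E.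
  by apply: nO0; rewrite t0E scale0r addr0.
have bd : boundary Omega (z + t0 *: v).
  split; last by move=> /interior_subset.
  move=> B /nbhs_ballP[e /= e0 eB].
  have e1 : 0 < e / (`|v| + 1) by rewrite divr_gt0.
  pose t := Num.max 0 (t0 - e / (`|v| + 1) / 2).
  have tt0 : t < t0 by rewrite /t gt_max t0_gt0/=; lra.
  have tge0 : 0 <= t by rewrite le_max lexx.
  exists (z + t *: v); split.
    apply: contrapT => nt; have := tt0; apply/negP; rewrite -leNgt.
    apply: ge_inf; first by case: infF.
    by split => //; rewrite tge0/= (le_trans (ltW tt0)).
  apply: eB; rewrite -ball_normE; apply: close => //.
  have tl : t0 - e / (`|v| + 1) / 2 <= t by rewrite le_max lexx orbT.
  have tt0' : 0 <= t0 - t by rewrite subr_ge0 ltW.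
  by rewrite (ger0_norm tt0'); lra.
have := boundary_distance_le z bd.
rewrite opprD addrA subrr add0r normrN normrZ ger0_norm//.
have := ler_wpM2r (normr_ge0 v) t01; lra.
Qed.

Hypothesis Omega_convex : forall x y (l : R), 0 <= l <= 1 ->
  Omega x -> Omega y -> Omega (l *: x + (1 - l) *: y).

(** The convex hull of the balls of radius d(x) around x and d(y) around y lies in
the convex set Omega, and it contains the ball of interpolated radius around the
interpolated centre. *)
Lemma boundary_distance_concave x y (l : R) : 0 <= l <= 1 -> Omega x -> Omega y ->
  l * d x + (1 - l) * d y <= d (l *: x + (1 - l) *: y).
Proof.
move=> l01 Ox Oy.
have [l0 l1] := andP l01.
have dx := boundary_distance_gt0 Ox; have dy := boundary_distance_gt0 Oy.
set D := l * d x + (1 - l) * d y.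
have D0 : 0 < D by rewrite /D; nra.
apply: boundary_distance_ge_ball => v vD.
have -> : l *: x + (1 - l) *: y + v =
    l *: (x + (d x / D) *: v) + (1 - l) *: (y + (d y / D) *: v).
  rewrite !scalerDr !scalerA addrACA -scalerDl !mulrA -mulrDl divff ?gt_eqF//.
  by rewrite scale1r.
have vD1 : `|v| / D < 1 by rewrite ltr_pdivrMr// mul1r.
have step z : Omega z -> 0 < d z -> Omega (z + (d z / D) *: v).
  move=> Oz dz; apply: boundary_distance_step => //.
  rewrite normrZ ger0_norm; last by rewrite divr_ge0// ltW.
  by rewrite mulrAC -mulrA gtr_pMr.
by apply: Omega_convex => //; exact: step.
Qed.

Hypothesis Omega_opp : forall x, Omega x -> Omega (- x).

Lemma boundary_distance_opp x : Omega x -> d x <= d (- x).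
Proof.
move=> Ox; apply: boundary_distance_ge_ball => v vd.
rewrite -[v]opprK -opprD; apply/Omega_opp/boundary_distance_step => //.
by rewrite normrN.
Qed.

(** The origin is the midpoint of [x] and [- x], and d is even and concave. *)
Lemma boundary_distance_le0 x : Omega x -> d x <= d 0.
Proof.
move=> Ox.
have h : 0 <= (2^-1 : R) <= 1 by lra.
have := boundary_distance_concave h Ox (Omega_opp Ox).
have -> : 1 - 2^-1 = 2^-1 :> R by lra.
rewrite scalerN subrr; have := boundary_distance_opp Ox; lra.
Qed.

Lemma boundary_distance_scale x (l : R) : 0 <= l <= 1 -> Omega 0 -> Omega x ->
  Omega (l *: x) /\ d x <= d (l *: x).
Proof.
move=> l01 O0 Ox; have := boundary_distance_concave l01 Ox O0.
have := Omega_convex l01 Ox O0; rewrite scaler0 addr0 => ?; split => //.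
have /andP[l0 l1] := l01; have := boundary_distance_le0 Ox; nra.
Qed.

End BoundaryDistance.

(** * Partitions and curve integrals of regular curves *)

Section Partitions.
Context {R : realType}.
Implicit Types s : seq R.

Lemma node_le s i : itv_partition 0 1 s -> (i < size s)%N -> node s i <= node s i.+1.
Proof.
move=> [ps _] si; rewrite /node /=; apply: ltW.
by move/(pathP 1): ps => /(_ i si).
Qed.

Lemma node_itv s i : itv_partition 0 1 s -> (i <= size s)%N -> 0 <= node s i <= 1.
Proof.
move=> ps si; rewrite /node.
by rewrite (itv_partition_nth_ge _ ps)//= (itv_partition_nth_le _ ps).
Qed.

Lemma sum_node s (f : R -> R) : itv_partition 0 1 s ->
  \sum_(0 <= i < size s) (f (node s i.+1) - f (node s i)) = f 1 - f 0.
Proof.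
move=> ps; rewrite telescope_sumr//.
by rewrite {1}/node (itv_partition_nth_size _ ps).
Qed.

Definition uniform_partition (n : nat) : seq R :=
  [seq i.+1%:R / n%:R | i <- iota 0 n].

Lemma size_uniform_partition n : size (uniform_partition n) = n.
Proof. by rewrite size_map size_iota. Qed.

Lemma node_uniform_partition n i : (0 < n)%N -> (i <= n)%N ->
  node (uniform_partition n) i = i%:R / n%:R.
Proof.
move=> n0; case: i => [|i] ni; first by rewrite /node/= mul0r.
by rewrite /node/= (nth_map 0%N) ?size_iota// nth_iota// add0n.
Qed.

Lemma uniform_partitionP n : (0 < n)%N -> itv_partition 0 1 (uniform_partition n).
Proof.
move=> n0; split.
  apply/(pathP 1) => i; rewrite size_uniform_partition => ni.
  change (node (uniform_partition n) i < node (uniform_partition n) i.+1).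
  rewrite !node_uniform_partition//; last exact: ltnW.
  by rewrite ltr_pM2r ?invr_gt0 ?ltr0n// ltr_nat.
rewrite (last_nth 1) -/(node _ _) size_uniform_partition node_uniform_partition//.
by rewrite divff// pnatr_eq0 -lt0n.
Qed.

Lemma uniform_partition_mesh n (e : R) i : (0 < n)%N -> e^-1 < n%:R -> 0 < e ->
  (i < n)%N ->
  node (uniform_partition n) i.+1 - node (uniform_partition n) i < e.
Proof.
move=> n0 en e0 ni; rewrite !node_uniform_partition//; last exact: ltnW.
rewrite -mulrBl -natrB// subSnn mul1r invf_plt ?posrE// ltr0n//.
Qed.

End Partitions.

Section RegularCurves.
Context {R : realType} {X : normedModType R}.
Variables (Omega : set X) (rho : X -> R).
Implicit Types (gamma : R -> X) (G W : R -> R).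

(** [G] is the primitive of the weight with respect to the arc length of [gamma], and
[W] is monotone and controls the error of a single term of a Riemann-Stieltjes
sum. A smooth arc contributes a linear part to [W] and a corner a jump. Since
the condition is pointwise in [s], [xi] and [t], it passes through gluing and
reparametrization without any manipulation of partitions. *)
Definition regular_curve (T L : R) gamma G W :=
  [/\ forall t, 0 <= t <= T -> Omega (gamma t) /\ 0 <= rho (gamma t) <= L,
      forall s t, 0 <= s -> s <= t -> t <= T ->
        [/\ `|gamma t - gamma s| <= L * (t - s), `|G t - G s| <= L * (t - s)
          & W s <= W t]
    & forall s xi t, 0 <= s -> s <= xi -> xi <= t -> t <= T ->
        `|rho (gamma xi) * `|gamma t - gamma s| - (G t - G s)|
          <= (t - s) * (W t - W s)].

Lemma lipschitz_curve_in (L : R) gamma : 0 <= L ->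
  (forall t, 0 <= t <= 1 -> Omega (gamma t)) ->
  (forall s t, 0 <= s -> s <= t -> t <= 1 -> `|gamma t - gamma s| <= L * (t - s)) ->
  curve_in Omega (gamma 0) (gamma 1) gamma /\ rectifiable gamma.
Proof.
move=> L0 O lip; split.
  split => //.
  apply/subspace_continuousP => x; rewrite /= in_itv/= => /andP[x0 x1].
  apply/cvgrPdist_lt => e e0; rewrite near_withinE.
  have e1 : 0 < e / (L + 1) by rewrite divr_gt0// ltr_wpDl.
  have close s t : 0 <= s -> s <= t -> t <= 1 -> t - s < e / (L + 1) ->
      `|gamma t - gamma s| < e.
    move=> s0 st t1; rewrite ltr_pdivlMr; last by rewrite ltr_wpDl.
    by move=> h; apply: le_lt_trans (lip _ _ s0 st t1) _; nra.
  near=> y; rewrite /= in_itv/= => /andP[y0 y1].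
  have : `|x - y| < e / (L + 1).
    by near: y; apply: (@cvgr_dist_lt _ _ _ _ _ id x _ _ e1).
  rewrite ltr_norml => /andP[h1 h2].
  have [xy|/ltW yx] := leP x y; last by apply: close.
  by rewrite distrC; apply: close => //; lra.
exists L => _ [s ps ->].
apply: (@le_trans _ _ (\sum_(0 <= i < size s) (L * node s i.+1 - L * node s i))).
  apply: ler_sum_nat => i /andP[_ si]; rewrite -mulrBr; apply: lip.
  - by case/andP: (node_itv ps (ltnW si)).
  - exact: node_le.
  - by case/andP: (node_itv ps si).
by rewrite (sum_node (fun t => L * t))//; lra.
Unshelve. all: by end_near. Qed.

(** The error of a Riemann-Stieltjes sum is at most the sum of the products of the
increments of [t] and of [W]; since [W] telescopes, it is at most the mesh times
the total increment of [W]. *)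
Lemma regular_curve_integral (T L : R) gamma G W : 0 <= T -> 0 <= L ->
  regular_curve T L gamma G W ->
  [/\ curve_in Omega (gamma 0) (gamma T) (fun t => gamma (T * t)),
      rectifiable (fun t => gamma (T * t))
    & is_curve_integral rho (fun t => gamma (T * t)) (G T - G 0)].
Proof.
move=> T0 L0 [gO lip osc].
have sc t : 0 <= t <= 1 -> 0 <= T * t <= T.
  by move=> /andP[t0 t1]; rewrite mulr_ge0//= ler_piMr.
have [|||+ +] := @lipschitz_curve_in (L * T) (fun t => gamma (T * t)).
- by rewrite mulr_ge0.
- by move=> t /sc/gO[].
- move=> s t s0 st t1; rewrite -mulrA mulrBr.
  have /andP[h1 _] : 0 <= T * s <= T by apply: sc; lra.
  have /andP[_ h2] : 0 <= T * t <= T by apply: sc; lra.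
  by have [] := lip _ _ h1 (ler_wpM2l T0 st) h2.
rewrite mulr0 mulr1 => cin rect; split => // e e0.
have W0 : 0 <= W T - W 0 by rewrite subr_ge0; have [] := lip 0 T.
exists (e / (T + 1) / (W T - W 0 + 1)).
  by rewrite !divr_gt0// ltr_wpDl.
move=> s xi ps mesh hxi.
set dl := e / _ / _ in mesh.
have -> : G T - G 0 = \sum_(0 <= i < size s) (G (T * node s i.+1) - G (T * node s i)).
  by rewrite (sum_node (fun t => G (T * t)))// mulr0 mulr1.
rewrite -sumrB.
apply: (@le_lt_trans _ _ (\sum_(0 <= i < size s)
    (T * dl * W (T * node s i.+1) - T * dl * W (T * node s i)))).
  apply: (le_trans (ler_norm_sum _ _ _)); apply: ler_sum_nat => i /andP[_ si].
  have [/andP[x0 x1]] := hxi _ si.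
  have /sc/andP[n0 _] := node_itv ps (ltnW si).
  have /sc/andP[_ n1] := node_itv ps si.
  have ns := node_le ps si.
  have wxi0 := ler_wpM2l T0 x0; have wxi1 := ler_wpM2l T0 x1.
  apply: (le_trans (osc _ _ _ n0 wxi0 wxi1 n1)).
  have [_ _ ww] := lip _ _ n0 (ler_wpM2l T0 ns) n1.
  by rewrite -!mulrBr ler_wpM2r ?subr_ge0// ler_wpM2l// ltW// mesh.
rewrite (sum_node (fun t => T * dl * W (T * t)))// mulr0 mulr1 -mulrBr.
have T1 : 0 < T + 1 by rewrite ltr_wpDl.
have W1 : 0 < W T - W 0 + 1 by rewrite ltr_wpDl.
have dl0 : 0 < dl by rewrite !divr_gt0.
have -> : e = dl * (W T - W 0 + 1) * (T + 1).
  by rewrite /dl divfK ?gt_eqF// divfK ?gt_eqF.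
have := mulr_ge0 T0 W0; nra.
Qed.

End RegularCurves.

(** * Extending a regular curve by a segment *)

Section Antiderivative.
Context {R : realType}.
Notation mu := (@lebesgue_measure R).

Lemma antiderivative_exists (f : R -> R) : continuous f ->
  exists G : R -> R, forall x : R, -1 < x -> x < 2 -> is_derive x 1 G (f x).
Proof.
move=> cf.
have fi : mu.-integrable `[-1, 2] (EFin \o f).
  apply: continuous_compact_integrable; first exact: segment_compact.
  exact: continuous_subspaceT.
exists (fun x => \int[mu]_(t in [set` `[-1, x]]) f t)%R => x x1 x2.
have [dG <-] := continuous_FTC1_closed x2 fi x1 (cf x).
by rewrite derive1E; exact: derivableP.
Qed.

(** The mean value form of the fundamental theorem of calculus; the primitive is
built on a larger interval so that the end points 0 and 1 are interior. *)
Lemma antiderivative_bounds (f : R -> R) : continuous f ->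
  exists G : R -> R, forall s t : R, 0 <= s -> s <= t -> t <= 1 ->
    exists2 u, s <= u <= t & G t - G s = f u * (t - s).
Proof.
move=> /antiderivative_exists[G dG]; exists G => s t s0 st t1.
have [||u ust ->] := @MVT_segment R G f s t st.
- by move=> x; rewrite in_itv/= => /andP[? ?]; apply: dG; lra.
- apply: derivable_within_continuous => x; rewrite in_itv/= => /andP[? ?].
  by have [] : is_derive x 1 G (f x) by apply: dG; lra.
by exists u => //; move: ust; rewrite in_itv.
Qed.

End Antiderivative.

Section RealAux.
Context {R : realType}.

Lemma exists_natr_gt (x : R) : exists2 n : nat, (0 < n)%N & x < n%:R.
Proof.
exists (Num.bound `|x|).+1 => //; apply: (le_lt_trans (ler_norm _)).
by rewrite (lt_le_trans (archi_boundP _))// ler_nat.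
Qed.

Lemma inv_lipschitz (k p q : R) : 0 < k -> k <= p -> k <= q ->
  `|p^-1 - q^-1| <= `|p - q| / k ^+ 2.
Proof.
move=> k0 kp kq; have p0 : 0 < p by exact: lt_le_trans kp.
have q0 : 0 < q by exact: lt_le_trans kq.
have -> : p^-1 - q^-1 = (q - p) / (p * q) by field; rewrite !gt_eqF.
rewrite normrM distrC normfV ler_wpM2l// gtr0_norm ?mulr_gt0//.
by rewrite lef_pV2 ?posrE ?exprn_gt0 ?mulr_gt0// expr2 ler_pM// ltW.
Qed.

Lemma max_lipschitz (p q k : R) : `|Num.max p k - Num.max q k| <= `|p - q|.
Proof.
have := ler_norm (q - p); rewrite distrC => h1; have h2 := ler_norm (p - q).
by rewrite /Num.max; do 2 case: ltP => ?; rewrite ler_norml; lra.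
Qed.

Lemma lipschitz_continuous (f : R -> R) (K : R) :
  (forall s t, `|f s - f t| <= K * `|s - t|) -> continuous f.
Proof.
move=> lip x; apply/cvgrPdist_lt => e e0.
have K0 : 0 < `|K| + 1 by rewrite ltr_wpDl.
have e1 : 0 < e / (`|K| + 1) by rewrite divr_gt0.
near=> y; apply: (le_lt_trans (lip _ _)).
have : `|x - y| < e / (`|K| + 1).
  by near: y; apply: (@cvgr_dist_lt _ _ _ _ _ id x _ _ e1).
rewrite ltr_pdivlMr//; apply: le_lt_trans.
by rewrite mulrC ler_wpM2l// (le_trans (ler_norm _))// lerDl.
Unshelve. all: by end_near. Qed.

End RealAux.

Section QuasihyperbolicUpper.
Context {R : realType} {X : normedModType R}.
Variable Omega : set X.

Local Notation d := (boundary_distance Omega).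

Lemma boundary_distance_ge0 z : 0 <= d z.
Proof.
rewrite /boundary_distance; set E := [set _ | _ in _].
have [E0|/set0P/negP/negPn/eqP ->] := pselect (E !=set0); last by rewrite inf0.
by apply: lb_le_inf => // _ [w _ <-].
Qed.

(** This bounds below the set whose infimum is the quasihyperbolic metric. *)
Lemma curve_integral_ge0 (rho : X -> R) gamma (I : R) :
  (forall x, 0 <= rho x) -> is_curve_integral rho gamma I -> 0 <= I.
Proof.
move=> rho0 cI; apply/ler_addgt0Pr => e e0.
have [dl dl0 h] := cI _ e0.
have [n n0 dn] := exists_natr_gt dl^-1.
pose s : seq R := uniform_partition n.
have ps : itv_partition 0 1 s by exact: uniform_partitionP.
have mesh i : (i < size s)%N -> node s i.+1 - node s i < dl.
  by rewrite size_uniform_partition; exact: uniform_partition_mesh.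
have tag i : (i < size s)%N -> node s i <= node s i <= node s i.+1.
  by move=> ni; rewrite lexx node_le.
have := h s (node s) ps mesh tag; set S := \sum_(0 <= i < _) _.
have : 0 <= S by apply: sumr_ge0 => i _; rewrite mulr_ge0.
rewrite ltr_norml => S0 /andP[_]; lra.
Qed.

Lemma quasihyperbolic_metric_le (T L : R) gamma G W : 0 <= T -> 0 <= L ->
  regular_curve Omega (fun z => (d z)^-1) T L gamma G W ->
  quasihyperbolic_metric Omega (gamma 0) (gamma T) <= G T - G 0.
Proof.
move=> T0 L0 rc; have [cin rect cint] := regular_curve_integral T0 L0 rc.
apply: ge_inf; last by exists (fun t => gamma (T * t)).
exists 0 => I [g [_ _]]; apply: curve_integral_ge0 => x.
by rewrite invr_ge0 boundary_distance_ge0.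
Qed.

End QuasihyperbolicUpper.

Section ExtendCurve.
Context {R : realType} {X : normedModType R}.
Variable Omega : set X.
Hypothesis Omega_open : open Omega.
Hypothesis boundary_neq0 : boundary Omega !=set0.
Implicit Types (x v : X).

Local Notation d := (boundary_distance Omega).
Local Notation rho := (fun z => (boundary_distance Omega z)^-1).

(** Along a segment of norm at most [a * d x] the distance to the boundary stays above
[(1 - eta) * d x], so its inverse is Lipschitz there; this yields the linear
control function [L * t], and the total weight is at most [a / (1 - eta)]. *)
Lemma segment_cost x v (a eta : R) : Omega x -> `|v| <= a * d x ->
  0 <= a -> a <= eta -> eta < 1 ->
  exists (g : R -> R) (L : R),
  [/\ 0 <= L,
      forall u, 0 <= u <= 1 -> Omega (x + u *: v) /\ 0 <= rho (x + u *: v) <= L,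
      forall s t, 0 <= s -> s <= t -> t <= 1 -> `|g t - g s| <= L * (t - s),
      forall s xi t, 0 <= s -> s <= xi -> xi <= t -> t <= 1 ->
        `|rho (x + xi *: v) * ((t - s) * `|v|) - (g t - g s)|
          <= (t - s) * (L * t - L * s)
    & g 1 - g 0 <= a / (1 - eta)].
Proof.
move=> Ox va a0 ae e1.
have dx := boundary_distance_gt0 Omega_open boundary_neq0 Ox.
pose k := (1 - eta) * d x.
have k0 : 0 < k by rewrite mulr_gt0// subr_gt0.
have v0 := normr_ge0 v.
have ki0 : 0 <= k^-1 by rewrite invr_ge0 ltW.
have vk0 : 0 <= `|v| / k by rewrite divr_ge0// ltW.
have uvn u : 0 <= u <= 1 -> `|u *: v| <= eta * d x.
  move=> /andP[u0 u1]; rewrite normrZ ger0_norm//.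
  apply: (@le_trans _ _ `|v|); first by rewrite ler_piMl.
  by apply: (le_trans va); rewrite ler_wpM2r// ltW.
have dk u : 0 <= u <= 1 -> k <= d (x + u *: v).
  move=> /uvn h; have := boundary_distance_sub x (x + u *: v) boundary_neq0.
  by rewrite opprD addrA subrr add0r normrN /k; lra.
have Ou u : 0 <= u <= 1 -> Omega (x + u *: v).
  move=> /uvn h; apply: boundary_distance_step => //.
  by apply: (le_lt_trans h); rewrite gtr_pMl.
have dlip s t : `|d (x + s *: v) - d (x + t *: v)| <= `|v| * `|s - t|.
  apply: (le_trans (boundary_distance_lip _ _ boundary_neq0)).
  by rewrite opprD addrACA subrr add0r -scalerBl normrZ mulrC.
(* The truncation at k makes the integrand continuous on the whole line. *)
pose f u := `|v| / Num.max (d (x + u *: v)) k.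
pose Q := `|v| * (`|v| / k ^+ 2).
have Q0 : 0 <= Q by rewrite !mulr_ge0// invr_ge0 exprn_ge0// ltW.
have flip s t : `|f s - f t| <= Q * `|s - t|.
  rewrite /f -mulrBr normrM normr_id /Q -mulrA ler_wpM2l//.
  apply: (le_trans (inv_lipschitz k0 _ _)); rewrite ?le_max ?lexx ?orbT//.
  rewrite mulrAC ler_wpM2r// ?invr_ge0 ?exprn_ge0 ?(ltW k0)//.
  exact: (le_trans (max_lipschitz _ _ _)).
have fE u : 0 <= u <= 1 -> f u = `|v| / d (x + u *: v).
  by move=> /dk h; rewrite /f max_l.
have fle u : 0 <= f u <= `|v| / k.
  have m0 : 0 < Num.max (d (x + u *: v)) k by rewrite lt_max k0 orbT.
  rewrite /f divr_ge0//=; last exact: ltW.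
  by rewrite ler_wpM2l// lef_pV2 ?posrE// le_max lexx orbT.
have [g gE] := antiderivative_bounds (lipschitz_continuous flip).
exists g, (k^-1 + `|v| / k + Q); split.
- by rewrite !addr_ge0.
- move=> u u01; split; first exact: Ou.
  have kd := dk _ u01; have d0 := lt_le_trans k0 kd.
  rewrite invr_ge0 ltW//=; apply: (@le_trans _ _ k^-1); first by rewrite lef_pV2.
  by rewrite -addrA lerDl addr_ge0.
- move=> s t s0 st t1; have [u ust ->] := gE s t s0 st t1.
  have /andP[f0 f1] := fle u.
  rewrite normrM !ger0_norm ?subr_ge0// ler_wpM2r ?subr_ge0//.
  by apply: (le_trans f1); rewrite -addrA addrCA lerDl addr_ge0.
- move=> s xi t s0 sx xt t1; have [|u /andP[su ut] ->] := gE s t s0 _ t1.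
    exact: le_trans xt.
  have -> : rho (x + xi *: v) * ((t - s) * `|v|) = f xi * (t - s).
    by rewrite fE; [rewrite /=; ring|lra].
  rewrite -mulrBl normrM [X in _ * X]ger0_norm ?subr_ge0//; last exact: le_trans xt.
  rewrite mulrC ler_wpM2l ?subr_ge0//; first exact: le_trans xt.
  apply: (le_trans (flip _ _)).
  have h : `|xi - u| <= t - s by rewrite ler_norml; lra.
  by rewrite -mulrBr ler_pM// lerDr addr_ge0.
have [u _ ->] := gE 0 1 (lexx _) ler01 (lexx _).
have /andP[_ f1] := fle u; rewrite subr0 mulr1; apply: (le_trans f1).
rewrite /k invfM mulrA mulrAC ler_pdivlMr; last by rewrite subr_gt0.
by rewrite divfK ?gt_eqF ?subr_gt0// ler_pdivrMr.
Qed.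

(** The corner at time [T] is absorbed by a jump of the control function that
dominates the crude Lipschitz bounds on any interval containing [T]. *)
Lemma regular_curve_extend (T L : R) gamma G W v (a eta : R) : 0 <= T -> 0 <= L ->
  regular_curve Omega rho T L gamma G W -> `|v| <= a * d (gamma T) ->
  0 <= a -> a <= eta -> eta < 1 ->
  exists gamma' G' W' L',
  [/\ 0 <= L', regular_curve Omega rho (T + 1) L' gamma' G' W',
      gamma' 0 = gamma 0, gamma' (T + 1) = gamma T + v
    & G' (T + 1) - G' 0 <= G T - G 0 + a / (1 - eta)].
Proof.
move=> T0 L0 [gO lip osc] va a0 ae e1.
have OT : Omega (gamma T) by have [] := gO T; rewrite ?T0 ?lexx.
have [g [M [M0 sO slip sosc gcost]]] := segment_cost OT va a0 ae e1.
(* m and q split the time into the part spent on gamma and the part spent on the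
   new segment. *)
pose m t := Num.min t T; pose q t := Num.max (t - T) 0.
pose K := L + M + `|v|.
have K0 : 0 <= K by rewrite !addr_ge0.
(* Per unit of time, a Riemann-Stieltjes term is at most K * K and an increment of
   G' at most K. *)
pose J := K * K + K.
pose gamma' t := gamma (m t) + q t *: v.
pose G' t := G (m t) + g (q t).
pose W' t := W (m t) + M * q t + (if T < t then J else 0).
have mq t : m t + q t = t.
  by rewrite /m /q /Num.min /Num.max; do 2 case: ltP => ?; lra.
have mlo t : t <= T -> m t = t by move=> h; rewrite /m min_l.
have qlo t : t <= T -> q t = 0 by move=> h; rewrite /q max_r// subr_le0.
have mhi t : T <= t -> m t = T by move=> h; rewrite /m min_r.
have qhi t : T <= t -> q t = t - T by move=> h; rewrite /q max_l// subr_ge0.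
have mle s t : s <= t -> m s <= m t by move=> h; rewrite /m le_min2 // lexx.
have qle s t : s <= t -> q s <= q t.
  by move=> h; rewrite /q ge_max !le_max lexx orbT lerD2r h.
have m0 t : 0 <= t -> 0 <= m t by move=> h; rewrite le_min h.
have mT t : m t <= T by rewrite ge_min lexx orbT.
have q0 t : 0 <= q t by rewrite le_max lexx orbT.
have q1 t : t <= T + 1 -> q t <= 1.
  by move=> h; rewrite ge_max ler01 andbT; lra.
have O' t : 0 <= t -> t <= T + 1 -> Omega (gamma' t) /\ 0 <= rho (gamma' t) <= K.
  move=> t0 t1; have [tT|/ltW tT] := leP t T.
    rewrite /gamma' mlo// qlo// scale0r addr0; have [|? /andP[? h]] := gO t.
      by rewrite t0.
    by split=> //; apply/andP; split => //; apply: (le_trans h); rewrite /K -addrA lerDl addr_ge0.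
  rewrite /gamma' mhi//; have [|? /andP[? h]] := sO (q t); first by rewrite q0 q1.
  by split=> //; apply/andP; split => //; apply: (le_trans h); rewrite /K -addrA addrCA lerDl addr_ge0.
have lip' s t : 0 <= s -> s <= t -> t <= T + 1 ->
    `|gamma' t - gamma' s| <= K * (t - s) /\ `|G' t - G' s| <= K * (t - s).
  move=> s0 st t1.
  have [h1 h2 _] := lip _ _ (m0 _ s0) (mle _ _ st) (mT t).
  have h3 := slip _ _ (q0 s) (qle _ _ st) (q1 _ t1).
  have y0 : 0 <= m t - m s by rewrite subr_ge0 mle.
  have z0 : 0 <= q t - q s by rewrite subr_ge0 qle.
  have tE : t - s = (m t - m s) + (q t - q s).
    by rewrite -[in LHS](mq t) -[in LHS](mq s) opprD addrACA.
  have v0 := normr_ge0 v.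
  split.
    have -> : gamma' t - gamma' s
        = gamma (m t) - gamma (m s) + (q t - q s) *: v.
      by rewrite /gamma' opprD addrACA -scalerBl.
    apply: (le_trans (ler_normD _ _)); rewrite normrZ (ger0_norm z0) tE /K.
    move: h1; move: (m t - m s) (q t - q s) y0 z0 => y z y0 z0 h1.
    have := mulr_ge0 M0 y0; have := mulr_ge0 v0 y0.
    by have := mulr_ge0 M0 z0; have := mulr_ge0 L0 z0; lra.
  have -> : G' t - G' s = G (m t) - G (m s) + (g (q t) - g (q s)).
    by rewrite /G' opprD addrACA.
  apply: (le_trans (ler_normD _ _)); rewrite tE /K.
  move: h2 h3; move: (m t - m s) (q t - q s) y0 z0 => y z y0 z0 h2 h3.
  have := mulr_ge0 M0 y0; have := mulr_ge0 v0 y0; have := mulr_ge0 v0 z0.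
  by have := mulr_ge0 L0 z0; lra.
have J0 : 0 <= J by rewrite addr_ge0// mulr_ge0.
have W'le s t : 0 <= s -> s <= t -> t <= T + 1 -> W' s <= W' t.
  move=> s0 st t1; have [_ _ h] := lip _ _ (m0 _ s0) (mle _ _ st) (mT t).
  rewrite /W' lerD ?lerD ?ler_wpM2l ?qle//.
  case: ltP => h1; last by case: ifP.
  by rewrite (lt_le_trans h1).
exists gamma', G', W', K; split => //.
- split; first by move=> t /andP[]; exact: O'.
    by move=> s t s0 st t1; have [] := lip' _ _ s0 st t1; split => //; exact: W'le.
  move=> s xi t s0 sx xt t1; have st := le_trans sx xt.
  have [tT|Tt] := leP t T.
    have sT := le_trans st tT; have xT := le_trans xt tT.
    rewrite /gamma' /G' /W' !mlo// !qlo// !scale0r !addr0 !mulr0 !addr0.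
    rewrite !ltNge tT sT/= !addr0.
    have -> : G t + g 0 - (G s + g 0) = G t - G s by ring.
    exact: osc.
  have [Ts|sT] := leP T s.
    have Tx := le_trans Ts sx.
    have -> : gamma' t - gamma' s = (t - s) *: v.
      rewrite /gamma' !mhi// ?(ltW Tt)// !qhi// ?(ltW Tt)//.
      by rewrite opprD addrACA subrr add0r -scalerBl; congr (_ *: _); ring.
    have -> : G' t - G' s = g (q t) - g (q s).
      by rewrite /G' !mhi// ?(ltW Tt)// opprD addrACA subrr add0r.
    have -> : gamma' xi = gamma T + q xi *: v by rewrite /gamma' mhi.
    have tsE : t - s = q t - q s by rewrite !qhi// ?(ltW Tt)//; ring.
    have ts0 : 0 <= t - s by rewrite subr_ge0.
    rewrite normrZ (ger0_norm ts0).
    apply: (@le_trans _ _ ((t - s) * (M * q t - M * q s))).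
      by rewrite tsE; apply: sosc; rewrite ?qle ?q1.
    rewrite ler_wpM2l// /W' !mhi// ?(ltW Tt)// Tt.
    by case: ifP => _; lra.
  have [h1 h2] := lip' _ _ s0 st t1.
  have [_ /andP[r0 rK]] := O' xi (le_trans s0 sx) (le_trans xt t1).
  apply: (@le_trans _ _ ((t - s) * J)).
    apply: (le_trans (ler_normB _ _)); rewrite normrM normr_id (ger0_norm r0) /J.
    have := ler_pM r0 (normr_ge0 _) rK h1; lra.
  rewrite ler_wpM2l ?subr_ge0// /W' Tt ltNge (ltW sT)/=.
  have [_ _ h] := lip _ _ (m0 _ s0) (mle _ _ st) (mT t).
  by have := ler_wpM2l M0 (qle _ _ st); lra.
- by rewrite /gamma' mlo// qlo// scale0r addr0.
- rewrite /gamma' mhi ?lerDl// qhi ?lerDl//.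
  by rewrite addrAC subrr add0r scale1r.
- rewrite /G' (mlo 0)// (qlo 0)// mhi ?lerDl// qhi ?lerDl//.
  have -> : T + 1 - T = 1 by ring.
  by lra.
Qed.

End ExtendCurve.

(** * Chains and the quasihyperbolic metric *)

Section Chains.
Context {R : realType} {X : normedModType R}.
Variable Omega : set X.
Implicit Types (x y v w : X) (z : nat -> X) (m n : nat).

Local Notation d := (boundary_distance Omega).
Local Notation rho := (fun u : X => (boundary_distance Omega u)^-1).
Local Notation k := (quasihyperbolic_metric Omega 0).

Definition symmetric_convex_domain :=
  [/\ open Omega, boundary Omega !=set0, Omega 0,
      forall x, Omega x -> Omega (- x)
    & forall x y (l : R), 0 <= l <= 1 -> Omega x -> Omega y ->
        Omega (l *: x + (1 - l) *: y)].

(** An Euler polygon of the differential inclusion |z'| <= d(z), started at 0, with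
time steps [a i]. *)
Definition qh_chain (a : nat -> R) n z :=
  z 0%N = 0 /\ forall i, (i < n)%N -> `|z i.+1 - z i| <= a i * d (z i).

Definition reachable (dl : R) n x :=
  exists2 z, qh_chain (fun=> dl) n z & z n = x.

Lemma reachable0 (dl : R) : reachable dl 0 0.
Proof. by exists (fun=> 0) => //; split. Qed.

Lemma reachable_step (dl : R) n x v : reachable dl n x -> `|v| <= dl * d x ->
  reachable dl n.+1 (x + v).
Proof.
move=> [z [z0 zs] <-] vdl; exists (fun i => if (i <= n)%N then z i else z n + v).
  split=> [|i]; first by rewrite leq0n.
  rewrite ltnS => ilen; rewrite ilen; case: (ltnP i n) => [/zs //|nlei].
  have -> : i = n by apply/eqP; rewrite eqn_leq ilen.
  by rewrite addrAC subrr add0r.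
by rewrite ltnn.
Qed.

Lemma reachable_leq (dl : R) n m x : 0 <= dl -> reachable dl n x -> (n <= m)%N ->
  reachable dl m x.
Proof.
move=> dl0 rx; elim: m => [|m IH]; first by rewrite leqn0 => /eqP <-.
rewrite leq_eqVlt => /orP[/eqP <- //|/IH h].
rewrite -[x]addr0; apply: reachable_step => //.
by rewrite normr0 mulr_ge0// boundary_distance_ge0.
Qed.

Hypothesis Omega_dom : symmetric_convex_domain.

(** Each step of the chain is a segment of cost at most [a i / (1 - eta)], attached to
the polygon through the previous points. *)
Lemma polygon_curve (a : nat -> R) (eta : R) n z :
  qh_chain a n z -> (forall i, (i < n)%N -> 0 <= a i <= eta) -> eta < 1 ->
  exists gamma G W L,
  [/\ 0 <= L, regular_curve Omega rho n%:R L gamma G W, gamma 0 = 0, gamma n%:R = z n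
    & G n%:R - G 0 <= (\sum_(0 <= i < n) a i) / (1 - eta)].
Proof.
have [Oo Ob O0 _ _] := Omega_dom.
move=> [z0 zs] a01 e1.
elim: n zs a01 => [|n IH] zs a01.
  exists (fun=> 0), (fun=> 0), (fun=> 0), (rho 0).
  have r0 : 0 <= rho 0 by rewrite invr_ge0 boundary_distance_ge0.
  rewrite big_geq// mul0r subrr; split => //; split.
  - by move=> t _; split => //; rewrite r0 lexx.
  - move=> s t _ st _; have h : 0 <= rho 0 * (t - s) by rewrite mulr_ge0 ?subr_ge0.
    by rewrite !subrr !normr0; split.
  - by move=> s xi t _ _ _ _; rewrite !subrr normr0 !mulr0 subrr normr0.
have [|i ni|g [G [W [L [L0 rc g0 gn Gc]]]]] := IH.
- by move=> i ni; apply: zs; rewrite ltnS ltnW.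
- by apply: a01; rewrite ltnS ltnW.
have /andP[an0 ane] := a01 n (ltnSn _).
have := zs n (ltnSn _); rewrite -gn => va.
have [g' [G' [W' [L' [L'0 rc' g'0 g'n G'c]]]]] :=
  regular_curve_extend Oo Ob (ler0n _ _) L0 rc va an0 ane e1.
exists g', G', W', L'; rewrite -natr1; split => //.
- by rewrite g'0.
- by rewrite g'n gn addrC subrK.
- by apply: (le_trans G'c); rewrite big_nat_recr//= mulrDl lerD2r.
Qed.

Lemma chain_metric_le (a : nat -> R) (eta : R) n z :
  qh_chain a n z -> (forall i, (i < n)%N -> 0 <= a i <= eta) -> eta < 1 ->
  Omega (z n) /\ k (z n) <= (\sum_(0 <= i < n) a i) / (1 - eta).
Proof.
move=> cz a01 e1; have [g [G [W [L [L0 rc g0 gn Gc]]]]] := polygon_curve cz a01 e1.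
split.
  by rewrite -gn; have [h _ _] := rc; have [] := h n%:R; rewrite ?ler0n ?lexx.
apply: le_trans Gc; rewrite -{1}g0 -gn.
exact: quasihyperbolic_metric_le rc.
Qed.

Lemma reachable_metric_le (dl : R) n x : 0 <= dl -> dl < 1 -> reachable dl n x ->
  Omega x /\ k x <= n%:R * dl / (1 - dl).
Proof.
move=> dl0 dl1 [z cz <-].
have [|Oz kz] := chain_metric_le cz _ dl1.
  by move=> i _; rewrite dl0 lexx.
by split => //; move: kz; rewrite sumr_const_nat subn0 mulr_natl.
Qed.

(** By concavity d does not decrease from [x] towards 0, so [c] bounds it from below
along the whole segment. *)
Lemma straight_reachable x (c : R) n : (0 < n)%N -> 0 < c -> Omega x -> c <= d x ->
  reachable (`|x| / c / n%:R) n x.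
Proof.
have [Oo Ob O0 OV OC] := Omega_dom.
move=> n0 c0 Ox cd; have n0' : (0 : R) < n%:R by rewrite ltr0n.
exists (fun i => (i%:R / n%:R) *: x); last by rewrite divff ?gt_eqF// scale1r.
split=> [|i ni]; first by rewrite mul0r scale0r.
have i01 : 0 <= (i%:R / n%:R : R) <= 1.
  by rewrite divr_ge0//= ler_pdivrMr// mul1r ler_nat ltnW.
have [_ h] := boundary_distance_scale Oo Ob OC OV i01 O0 Ox.
rewrite -scalerBl -mulrBl -natrB// subSnn mul1r normrZ normfV (gtr0_norm n0').
rewrite mulrC mulrAC ler_wpM2r ?invr_ge0 ?(ltW n0')//.
rewrite -mulrA ler_peMr// ler_pdivlMl// mulr1; exact: le_trans h.
Qed.

(** The real infimum of the empty set is 0, so comparing k with a number has a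
meaning only once an admissible curve is known. *)
Lemma metric_curve_exists x : Omega x -> exists I, exists gamma,
   [/\ curve_in Omega 0 x gamma, rectifiable gamma & is_curve_integral rho gamma I].
Proof.
move=> Ox; have [Oo Ob O0 OV OC] := Omega_dom.
have dx := boundary_distance_gt0 Oo Ob Ox.
have [n n0 hn] := exists_natr_gt (2 * (`|x| / d x)).
have n0' : (0 : R) < n%:R by rewrite ltr0n.
have [z cz <-] := straight_reachable n0 dx Ox (lexx _).
have h2 : (2^-1 : R) < 1 by lra.
have [|g [G [W [L [L0 rc g0 gn _]]]]] := polygon_curve cz _ h2.
  move=> i _; rewrite !divr_ge0//=; last exact: ltW.
  by rewrite ler_pdivrMr//; lra.
exists (G n%:R - G 0), (fun t => g (n%:R * t)); rewrite -g0 -gn.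
exact: regular_curve_integral rc.
Qed.

(** A segment of cost [a] is cut into equal pieces of cost at most [dl]; rounding
their number up loses at most one [dl]. *)
Lemma reachable_segment (dl a eta : R) n x v : 0 < dl ->
  reachable dl n x -> `|v| <= a * d x -> 0 <= a -> a <= eta -> eta < 1 ->
  exists2 m, m%:R * dl <= n%:R * dl + a / (1 - eta) + dl & reachable dl m (x + v).
Proof.
have [Oo Ob O0 OV OC] := Omega_dom.
move=> dl0 rx va a0 ae e1; have e1' : 0 < 1 - eta by rewrite subr_gt0.
pose b := a / (1 - eta) / dl.
have b0 : 0 <= b by rewrite !divr_ge0// ltW.
pose j := (Num.truncn b).+1.
have j0 : (0 : R) < j%:R by rewrite ltr0n.
have /andP[jb bj] : (Num.truncn b)%:R <= b < j%:R by exact: truncn_itv.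
exists (n + j)%N.
  rewrite natrD /j -natr1 !mulrDl mul1r addrA lerD2r lerD2l.
  by rewrite -ler_pdivlMr.
have dx0 : 0 <= d x by exact: boundary_distance_ge0.
have st i : (i <= j)%N -> reachable dl (n + i) (x + (i%:R / j%:R) *: v).
  elim: i => [_|i IH ij]; first by rewrite addn0 mul0r scale0r addr0.
  have -> : x + (i.+1%:R / j%:R) *: v = x + (i%:R / j%:R) *: v + j%:R^-1 *: v.
    by rewrite -addrA -scalerDl -natr1 mulrDl mul1r.
  rewrite addnS; apply: reachable_step; first exact/IH/ltnW.
  have i01 : i%:R / j%:R <= 1 :> R by rewrite ler_pdivrMr// mul1r ler_nat ltnW.
  have := boundary_distance_sub x (x + (i%:R / j%:R) *: v) Ob.
  rewrite opprD addrA subrr add0r normrN normrZ ger0_norm ?divr_ge0// => hd.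
  have hd' : (1 - eta) * d x <= d (x + (i%:R / j%:R) *: v).
    have := ler_wpM2r (normr_ge0 v) i01; have := ler_wpM2r dx0 ae; lra.
  rewrite normrZ gtr0_norm ?invr_gt0// ler_pdivrMl//.
  apply: (le_trans va); apply: (@le_trans _ _ (j%:R * (dl * ((1 - eta) * d x)))).
    rewrite !mulrA ler_wpM2r//.
    by move: bj; rewrite /b !ltr_pdivrMr// => /ltW.
  by rewrite ler_wpM2l ?ler_wpM2l// ltW.
by have := st j (leqnn _); rewrite divff ?gt_eqF// scale1r.
Qed.

Lemma curve_uniformly_continuous (g : R -> X) : {within `[0, 1], continuous g} ->
  forall e, 0 < e -> exists2 dl, 0 < dl & forall s t, 0 <= s <= 1 -> 0 <= t <= 1 ->
    `|s - t| < dl -> `|g s - g t| < e.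
Proof.
move=> cg e e0.
have e2 : 0 < e / 2 by rewrite divr_gt0.
pose P (dl s : R) := forall t, 0 <= s <= 1 -> 0 <= t <= 1 ->
    `|s - t| < dl -> `|g s - g t| < e.
have loc (x : R) : `[0, 1]%classic x -> \forall s \near x & dl \near 0^'+, P dl s.
  move=> xA; move/subspace_continuousP : cg => /(_ x xA)/cvgrPdist_lt/(_ _ e2).
  rewrite near_withinE => /nbhs_ballP[r /= r0 hr].
  have r2 : 0 < r / 2 by rewrite divr_gt0.
  have close t : 0 <= t <= 1 -> `|x - t| < r -> `|g x - g t| < e / 2.
    by move=> t01 xt; apply: hr; rewrite -?ball_normE//= in_itv.
  near=> s dl => t s01 t01 st.
  have xs : `|x - s| < r / 2.
    by near: s; apply: (@cvgr_dist_lt _ _ _ _ _ id x _ _ r2).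
  have dlr : dl < r / 2 by near: dl; exact: nbhs_right_lt.
  have h1 : `|g x - g s| < e / 2 by apply: close => //; lra.
  have h2 : `|g x - g t| < e / 2.
    apply: close => //; apply: (le_lt_trans (ler_distD s _ _)).
    by rewrite [ltRHS]splitr ltrD//; exact: lt_trans dlr.
  by have := ler_distD (g x) (g s) (g t); rewrite [`|g s - g x|]distrC; lra.
have := (compact_near_coveringP _).1 (@segment_compact R 0 1) R 0^'+ P _ loc.
move=> nP; have [dl [dl0 hdl]] : exists dl, 0 < dl /\ `[0, 1]%classic `<=` P dl.
  apply: (@filter_ex _ (0^'+ : set_system R)).
  by near=> dl; split; [near: dl; exact: nbhs_right_gt|near: dl; exact: nP].
exists dl => // s t s01; have sA : `[0, 1]%classic s by rewrite /= in_itv.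
by apply: (hdl s sA).
Unshelve. all: by end_near. Qed.

(** A fine partition of an almost optimal curve gives a chain of n steps with total
cost below [c]; cutting each of its segments into pieces of cost [dl] loses at
most [n * dl], which is negligible once [dl] is small compared with 1 / n. That all
small [dl] are available makes it possible to give two points chains with common
costs. *)
Lemma curve_reachable x (c : R) : Omega x -> k x < c ->
  exists2 dl0, 0 < dl0 & forall dl, 0 < dl -> dl < dl0 ->
    exists2 m, m%:R * dl <= c & reachable dl m x.
Proof.
have [Oo Ob O0 OV OC] := Omega_dom.
move=> Ox kc.
have [I [g [[cg g0 g1 gO] _ Ig]] Ic] : exists2 I, (exists gamma,
    [/\ curve_in Omega 0 x gamma, rectifiable gamma
      & is_curve_integral rho gamma I]) & I < c.
  apply: contrapT => nI; move: kc; apply/negP; rewrite -leNgt.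
  apply: lb_le_inf => [|I EI]; first exact: metric_curve_exists.
  by rewrite leNgt; apply/negP => Ic; apply: nI; exists I.
have I0 : 0 <= I.
  by apply: curve_integral_ge0 Ig => u; rewrite invr_ge0 boundary_distance_ge0.
have [kp kp0 dkp] : exists2 kp, 0 < kp & forall t, 0 <= t <= 1 -> kp <= d (g t).
  have cd : {within `[0, 1], continuous (fun t : R => d (g t))}.
    apply/subspace_continuousP => t tA.
    move/subspace_continuousP : cg => /(_ t tA)/cvgrPdist_lt h.
    apply/cvgrPdist_lt => e e0; apply: filterS (h e e0) => y.
    exact: le_lt_trans (boundary_distance_lip _ _ Ob).
  have [t tA tmin] := EVT_min ler01 cd.
  exists (d (g t)); first by apply: boundary_distance_gt0 => //; exact: gO.
  by move=> s s01; apply: tmin; rewrite in_itv.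
pose c1 := (I + c) / 2.
have Ic1 : I < c1 by rewrite /c1; lra.
have c1c : c1 < c by rewrite /c1; lra.
have c1_gt0 : 0 < c1 by lra.
have c_gt0 : 0 < c by lra.
(* With this choice c1 / (1 - eta) < c still holds. *)
pose eta := (c - c1) / (2 * c).
have eta0 : 0 < eta by rewrite divr_gt0 ?mulr_gt0 ?subr_gt0.
have eta1 : eta < 1 by rewrite ltr_pdivrMr ?mulr_gt0//; lra.
have eta1' : 0 < 1 - eta by lra.
pose slack := c - c1 / (1 - eta).
have slack0 : 0 < slack.
  have ceta : c * eta = (c - c1) / 2 by rewrite /eta; field; rewrite gt_eqF.
  by rewrite subr_gt0 ltr_pdivrMr// mulrBr mulr1 ceta; lra.
have [dl1 dl10 hdl1] := Ig _ (ltac:(by rewrite subr_gt0) : 0 < c1 - I).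
have [dl2 dl20 hdl2] := curve_uniformly_continuous cg (mulr_gt0 eta0 kp0).
(* dl1 makes the sums close to the integral, dl2 makes every step cheap. *)
have [n n0 hn] := exists_natr_gt (Num.max dl1^-1 dl2^-1).
have n0' : (0 : R) < n%:R by rewrite ltr0n.
move: hn; rewrite gt_max => /andP[hn1 hn2].
pose s : seq R := uniform_partition n.
have ps : itv_partition 0 1 s by exact: uniform_partitionP.
have sz : size s = n by exact: size_uniform_partition.
have mesh i : (i < size s)%N -> node s i.+1 - node s i < dl1.
  by rewrite sz; exact: uniform_partition_mesh.
have tag i : (i < size s)%N -> node s i <= node s i <= node s i.+1.
  by move=> ni; rewrite lexx node_le.
have := hdl1 s (node s) ps mesh tag; rewrite sz.
pose a i := rho (g (node s i)) * `|g (node s i.+1) - g (node s i)|.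
rewrite -/(a _) ltr_norml => /andP[_ sumc].
have {}sumc : \sum_(0 <= i < n) a i < c1 by move: sumc; rewrite /a; lra.
exists (slack / n%:R); first by rewrite divr_gt0.
move=> dl dl0; rewrite ltr_pdivlMr// => dls.
have main i : (i <= n)%N -> exists2 m,
    m%:R * dl <= (\sum_(0 <= l < i) a l) / (1 - eta) + i%:R * dl &
    reachable dl m (g (node s i)).
  elim: i => [_|i IH ilen].
    exists 0%N; first by rewrite big_geq// !mul0r addr0.
    by rewrite /node/= g0; exact: reachable0.
  have [m mdl rm] := IH (ltnW ilen).
  have ni := node_itv ps; rewrite sz in ni.
  have hd := dkp _ (ni _ (ltnW ilen)); have hd0 := lt_le_trans kp0 hd.
  have va : `|g (node s i.+1) - g (node s i)| = a i * d (g (node s i)).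
    by rewrite /a mulrAC mulVf ?gt_eqF// mul1r.
  have a0 : 0 <= a i by rewrite mulr_ge0// invr_ge0 ltW.
  have ae : a i <= eta.
    rewrite /a mulrC ler_pdivrMr//; apply: ltW.
    apply: (@lt_le_trans _ _ (eta * kp)); last by rewrite ler_wpM2l// ltW.
    apply: hdl2; rewrite ?ni//; first exact: ltnW.
    rewrite ger0_norm ?subr_ge0 ?node_le ?sz//.
    exact: uniform_partition_mesh.
  have va' : `|g (node s i.+1) - g (node s i)| <= a i * d (g (node s i)) by rewrite va.
  have [m' m'dl rm'] := reachable_segment dl0 rm va' a0 ae eta1.
  exists m'; last by rewrite addrC subrK in rm'.
  apply: (le_trans m'dl).
  by rewrite big_nat_recr//= mulrDl -natr1 mulrDl mul1r; lra.
have [m mdl rm] := main n (leqnn _).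
exists m; last by move: rm; rewrite -{1}sz /node (itv_partition_nth_size _ ps) g1.
apply: (le_trans mdl).
have : (\sum_(0 <= l < n) a l) / (1 - eta) <= c1 / (1 - eta).
  by rewrite ler_wpM2r ?invr_ge0 ?ltW.
by move: dls; rewrite /slack; lra.
Qed.

End Chains.

(** * Scaling, convexity and size of quasihyperbolic balls *)

Section MetricBalls.
Context {R : realType} {X : normedModType R}.
Variable Omega : set X.
Hypothesis Omega_dom : symmetric_convex_domain Omega.
Implicit Types (x y v w h : X) (z : nat -> X) (m n : nat).

Local Notation d := (boundary_distance Omega).
Local Notation k := (quasihyperbolic_metric Omega 0).
Local Notation reachable := (reachable Omega).
Local Notation qh_chain := (qh_chain Omega).

(** The factors [1 - eta] of the chain estimates disappear when the mesh of the chains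
tends to 0. *)
Lemma le_of_small_factor (T S K : R) :
  (forall e, 0 < e -> exists2 dl, 0 < dl < e & T * (1 - K * dl) <= S) -> T <= S.
Proof.
move=> h; apply/ler_addgt0Pr => e e0.
have p0 : 0 < `|T * K| + 1 by rewrite ltr_wpDl.
have [dl /andP[dl0 dle] hS] := h _ (divr_gt0 e0 p0).
have : T * K * dl <= e.
  rewrite ltr_pdivlMr// in dle; apply: le_trans (ltW dle); rewrite mulrC ler_wpM2l ?(ltW dl0)//.
  by rewrite (le_trans (ler_norm _))// lerDl.
by move: hS; rewrite mulrBr mulr1 mulrA; lra.
Qed.

Lemma chain_in (dl : R) n z i : 0 <= dl -> dl < 1 -> qh_chain (fun=> dl) n z ->
  (i <= n)%N -> Omega (z i).
Proof.
move=> dl0 dl1 [z0 zs] ilen.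
have [] // := @reachable_metric_le _ _ _ Omega_dom dl i (z i) dl0 dl1.
by exists z => //; split => // l li; apply: zs; exact: leq_trans ilen.
Qed.

(** Scaling by [l] shortens the steps by [l] and does not decrease d. *)
Lemma reachable_scale (dl l : R) n x : 0 <= dl -> dl < 1 -> 0 <= l <= 1 ->
  reachable dl n x -> reachable (l * dl) n (l *: x).
Proof.
have [Oo Ob O0 OV OC] := Omega_dom.
move=> dl0 dl1 l01 [z cz <-]; exists (fun i => l *: z i) => //.
have [z0 zs] := cz; split=> [|i ni]; first by rewrite z0 scaler0.
have Oz := chain_in dl0 dl1 cz (ltnW ni).
have [_ hd] := boundary_distance_scale Oo Ob OC OV l01 O0 Oz.
have /andP[l0 _] := l01.
rewrite -scalerBr normrZ_ge0// -mulrA ler_wpM2l//.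
by apply: (le_trans (zs _ ni)); rewrite ler_wpM2l.
Qed.

Lemma reachable_opp (dl : R) n x : 0 <= dl -> dl < 1 ->
  reachable dl n x -> reachable dl n (- x).
Proof.
have [Oo Ob O0 OV OC] := Omega_dom.
move=> dl0 dl1 [z cz <-]; exists (fun i => - z i) => //.
have [z0 zs] := cz; split=> [|i ni]; first by rewrite z0 oppr0.
have Oz := chain_in dl0 dl1 cz (ltnW ni).
rewrite -opprD normrN; apply: (le_trans (zs _ ni)); rewrite ler_wpM2l//.
exact: boundary_distance_opp.
Qed.

(** By concavity of d, chains with the same costs form a convex set. *)
Lemma reachable_convex (dl l : R) n x y : 0 <= dl -> dl < 1 -> 0 <= l <= 1 ->
  reachable dl n x -> reachable dl n y -> reachable dl n (l *: x + (1 - l) *: y).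
Proof.
have [Oo Ob O0 OV OC] := Omega_dom.
move=> dl0 dl1 l01 [z cz <-] [z' cz' <-].
exists (fun i => l *: z i + (1 - l) *: z' i) => //.
have [[z0 zs] [z'0 z's]] := (cz, cz').
split=> [|i ni]; first by rewrite z0 z'0 !scaler0 addr0.
have Oz := chain_in dl0 dl1 cz (ltnW ni).
have Oz' := chain_in dl0 dl1 cz' (ltnW ni).
have hd := boundary_distance_concave Oo Ob OC l01 Oz Oz'.
apply: le_trans (ler_wpM2l dl0 hd).
have /andP[l0 l1] := l01.
rewrite opprD addrACA -!scalerBr (le_trans (ler_normD _ _))//.
rewrite !normrZ_ge0 ?subr_ge0// mulrDr mulrCA [dl * (_ * d (z' i))]mulrCA.
by rewrite lerD// ler_wpM2l ?subr_ge0// ?zs// z's.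
Qed.

Lemma metric_le_of_reachable x (S K : R) : 0 <= K ->
  (forall e, 0 < e -> exists dl n, [/\ 0 < dl < e, n%:R * (K * dl) <= S
     & reachable (K * dl) n x]) ->
  Omega x /\ k x <= S.
Proof.
move=> K0 h.
have h' e : 0 < e -> exists dl n, [/\ 0 < dl < e, n%:R * (K * dl) <= S,
    0 <= K * dl < 1 & reachable (K * dl) n x].
  move=> e0; have p0 : 0 < K + 1 by rewrite ltr_wpDl.
  have m0 : 0 < Num.min e (K + 1)^-1 by rewrite lt_min e0 invr_gt0.
  have [dl [n [/andP[dl0]]]] := h _ m0; rewrite lt_min => /andP[dle dlK] hn hr.
  exists dl, n; split => //; first by rewrite dl0.
  rewrite mulr_ge0 ?(ltW dl0)//=.
  move: dlK; rewrite -[X in _ < X]mul1r ltr_pdivlMr// => dlK.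
  by apply: le_lt_trans dlK; rewrite mulrC ler_wpM2l ?(ltW dl0)// lerDl.
split.
  have [dl [n [_ _ /andP[dl0 dl1]]]] := h' _ ltr01.
  by move=> /(reachable_metric_le Omega_dom dl0 dl1)[].
apply: (@le_of_small_factor _ _ K) => e /h'[dl [n [dle hS /andP[dl0 dl1]]]].
move=> /(reachable_metric_le Omega_dom dl0 dl1)[_ hk].
exists dl => //; apply: le_trans hS.
by rewrite -ler_pdivlMr// subr_gt0.
Qed.

Lemma metric_reachable x (c e : R) : Omega x -> k x < c -> 0 < e ->
  exists2 dl0, 0 < dl0 <= e & forall dl, 0 < dl -> dl < dl0 ->
    exists2 m, m%:R * dl <= c & reachable dl m x.
Proof.
move=> Ox kc e0; have [dl0 dl00 h] := curve_reachable Omega_dom Ox kc.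
exists (Num.min dl0 e); first by rewrite lt_min dl00 e0 ge_min lexx orbT.
by move=> dl dlp; rewrite lt_min => /andP[h1 _]; exact: h.
Qed.

Lemma metric_scale x (l : R) : 0 <= l <= 1 -> Omega x ->
  Omega (l *: x) /\ k (l *: x) <= l * k x.
Proof.
move=> l01 Ox; have /andP[l0 l1] := l01.
suff h c : k x < c -> Omega (l *: x) /\ k (l *: x) <= l * c.
  split; first by have [] := h (k x + 1) ltac:(by rewrite ltrDl).
  apply/ler_addgt0Pr => e e0.
  have [_ hk] := h (k x + e) ltac:(by rewrite ltrDl).
  by apply: (le_trans hk); rewrite mulrDr lerD2l ler_piMl// ltW.
move=> kc; apply: (@metric_le_of_reachable _ _ l) => // e e0.
have e1 : 0 < Num.min e 1 by rewrite lt_min e0 ltr01.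
have [dl0 /andP[dl00 dl0e] hr] := metric_reachable Ox kc e1.
pose dl := dl0 / 2; have dlp : 0 < dl by rewrite divr_gt0.
have dll : dl < dl0 by rewrite /dl; lra.
have [m mdl rm] := hr _ dlp dll.
move: dl0e; rewrite le_min => /andP[dl0e dl01].
exists dl, m; split.
- by rewrite dlp (lt_le_trans dll).
- by rewrite mulrCA ler_wpM2l.
- by apply: reachable_scale => //; [exact: ltW|exact: lt_le_trans dl01].
Qed.

Lemma metric_opp x : Omega x -> k (- x) <= k x.
Proof.
move=> Ox; apply/ler_addgt0Pr => e e0.
have kc : k x < k x + e by rewrite ltrDl.
have [//||_ //] := @metric_le_of_reachable (- x) (k x + e) 1 => e' e'0.
have e1 : 0 < Num.min e' 1 by rewrite lt_min e'0 ltr01.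
have [dl0 /andP[dl00 dl0e] hr] := metric_reachable Ox kc e1.
pose dl := dl0 / 2; have dlp : 0 < dl by rewrite divr_gt0.
have dll : dl < dl0 by rewrite /dl; lra.
have [m mdl rm] := hr _ dlp dll.
move: dl0e; rewrite le_min => /andP[dl0e dl01].
exists dl, m; rewrite mul1r; split => //.
- by rewrite dlp (lt_le_trans dll).
- by apply: reachable_opp => //; [exact: ltW|exact: lt_le_trans dl01].
Qed.

Lemma metric_convex x y (l r : R) : 0 <= l <= 1 -> Omega x -> Omega y ->
  k x <= r -> k y <= r -> k (l *: x + (1 - l) *: y) <= r.
Proof.
move=> l01 Ox Oy kx ky; apply/ler_addgt0Pr => e e0.
have kxc : k x < r + e by rewrite (le_lt_trans kx)// ltrDl.
have kyc : k y < r + e by rewrite (le_lt_trans ky)// ltrDl.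
have [//||_ //] := @metric_le_of_reachable (l *: x + (1 - l) *: y) (r + e) 1 => e' e'0.
have e1 : 0 < Num.min e' 1 by rewrite lt_min e'0 ltr01.
have [dl0 /andP[dl00 dl0e] hx] := metric_reachable Ox kxc e1.
have [dl1 /andP[dl10 _] hy] := metric_reachable Oy kyc dl00.
pose dl := Num.min dl0 dl1 / 2.
have dlm : 0 < Num.min dl0 dl1 by rewrite lt_min dl00.
have dlp : 0 < dl by rewrite divr_gt0.
have : dl < Num.min dl0 dl1 by rewrite /dl; lra.
rewrite lt_min => /andP[dll0 dll1].
have [m mdl rm] := hx _ dlp dll0; have [n ndl rn] := hy _ dlp dll1.
move: dl0e; rewrite le_min => /andP[dl0e dl01].
have dlp0 := ltW dlp.
exists dl, (maxn m n); rewrite mul1r; split => //.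
- by rewrite dlp (lt_le_trans dll0).
- by rewrite /maxn; case: ifP.
- apply: reachable_convex => //; first exact: lt_le_trans dl01.
    by apply: reachable_leq rm _ => //; exact: leq_maxl.
  by apply: reachable_leq rn _ => //; exact: leq_maxr.
Qed.

Lemma metric_small x (r : R) : 0 < r -> `|x| <= Num.min 2^-1 (r / 2) * d 0 ->
  Omega x /\ k x <= r.
Proof.
set dl := Num.min _ _ => r0 xdl.
have dl0 : 0 < dl by rewrite lt_min invr_gt0 ltr0n divr_gt0.
have dlh : dl <= 2^-1 by rewrite ge_min lexx.
have dlr : dl <= r / 2 by rewrite ge_min lexx orbT.
have rx : reachable dl 1 x.
  by rewrite -[x]add0r; apply: reachable_step => //; exact: reachable0.
have dl1 : dl < 1 by lra.
have [Ox kx] := reachable_metric_le Omega_dom (ltW dl0) dl1 rx.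
split => //; apply: (le_trans kx); rewrite mul1r ler_pdivrMr ?subr_gt0//.
by nra.
Qed.

(** A step of cost [dl] multiplies d by at least [1 - dl], which is at least
[expR (- (2 * dl))]; so points within bounded quasihyperbolic distance of 0 stay
away from the boundary. *)
Lemma chain_distance (dl : R) n z i : 0 <= dl -> dl <= 2^-1 ->
  qh_chain (fun=> dl) n z -> (i <= n)%N -> expR (- (2 * (i%:R * dl))) * d 0 <= d (z i).
Proof.
move=> dl0 dl1 [z0 zs]; have [_ Ob _ _ _] := Omega_dom.
elim: i => [_|i IH ni]; first by rewrite mul0r mulr0 oppr0 expR0 mul1r z0.
have hd := boundary_distance_sub (z i) (z i.+1) Ob.
have hs := zs _ ni; rewrite distrC in hs.
have h1 : (1 - dl) * d (z i) <= d (z i.+1) by lra.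
apply: le_trans h1.
have -> : - (2 * (i.+1%:R * dl)) = - (2 * dl) - 2 * (i%:R * dl).
  by rewrite -natr1; ring.
rewrite expRD -mulrA ler_pM ?expR_ge0 ?mulr_ge0 ?expR_ge0 ?boundary_distance_ge0//.
  have := expR_ge1Dx (2 * dl); rewrite expRN => he.
  have p0 : 0 < 1 + 2 * dl by lra.
  apply: (@le_trans _ _ (1 + 2 * dl)^-1).
    by rewrite lef_pV2 ?posrE// ?expR_gt0.
  rewrite -[leLHS]mul1r ler_pdivrMr//; nra.
exact/IH/ltnW.
Qed.

End MetricBalls.

(** * Variation of the end of a chain *)

Section Variation.
Context {R : realType} {X : normedModType R}.
Variable Omega : set X.
Hypothesis Omega_dom : symmetric_convex_domain Omega.
Implicit Types (x y v w h : X) (z : nat -> X) (m n : nat).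

Local Notation d := (boundary_distance Omega).
Local Notation k := (quasihyperbolic_metric Omega 0).
Local Notation qh_chain := (qh_chain Omega).

(** The displacement grows linearly from 0 at [z p] to [w] at [z (p + j)]. As
[`|w| <= 2 * q], the denominator is a lower bound of d at the displaced point. *)
Definition varied_cost (q : R) p j z w i : R :=
  if (i < p)%N then `|z i.+1 - z i| / d (z i)
  else `|z i.+1 - z i + j%:R^-1 *: w| / (d (z i) - 2 * q).

(** [K * dl] bounds the cost of every single step of the displaced chain, which makes
the passage from chains to curves lossless as [dl] tends to 0. *)
Lemma chain_variation (dl q kp : R) p j z w :
  0 < dl -> (0 < j)%N -> qh_chain (fun=> dl) (p + j) z ->
  (forall i, (i <= p + j)%N -> kp <= d (z i)) -> 0 < kp ->
  0 <= q -> `|w| <= 2 * q -> 4 * q <= kp ->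
  let K := 2 + 4 * q / (j%:R * dl * kp) in K * dl < 1 ->
  Omega (z (p + j)%N + w) /\
  k (z (p + j)%N + w) * (1 - K * dl) <= \sum_(0 <= i < p + j) varied_cost q p j z w i.
Proof.
move=> dl0 j0 [z0 zs] dkp kp0 q0 wq q4 K Kdl.
have [_ Ob _ _ _] := Omega_dom.
have j0' : (0 : R) < j%:R by rewrite ltr0n.
pose ph i : R := (i - p)%N%:R / j%:R.
pose z' i := z i + ph i *: w.
have phlo i : (i <= p)%N -> ph i = 0.
  by rewrite -subn_eq0 => /eqP e; rewrite /ph e mul0r.
have phS i : (p <= i)%N -> ph i.+1 - ph i = j%:R^-1.
  by move=> pi; rewrite /ph subSn// -mulrBl -natrB// subSnn mul1r.
have ph01 i : (i <= p + j)%N -> 0 <= ph i <= 1.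
  by move=> ipj; rewrite /ph divr_ge0//= ler_pdivrMr// mul1r ler_nat leq_subLR.
have z'E : z' (p + j)%N = z (p + j)%N + w.
  by rewrite /z' /ph addKn divff ?gt_eqF// scale1r.
have dz' i : (i <= p + j)%N -> d (z i) - 2 * q <= d (z' i).
  move=> /ph01/andP[p0 p1]; have := boundary_distance_sub (z i) (z' i) Ob.
  rewrite /z' opprD addrA subrr add0r normrN normrZ_ge0//.
  by have := ler_piMl (normr_ge0 w) p1; lra.
have dq i : (i <= p + j)%N -> 0 < d (z i) - 2 * q by move=> /dkp; lra.
have K0 : 0 <= K by rewrite addr_ge0// divr_ge0// !mulr_ge0// ltW.
have cz : qh_chain (varied_cost q p j z w) (p + j) z'.
  split=> [|i ipj]; first by rewrite /z' phlo// scale0r addr0.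
  have di := dq _ (ltnW ipj); have di' := dz' _ (ltnW ipj).
  rewrite /varied_cost; case: ltnP => ip.
    have dzi : 0 < d (z i) by apply: lt_le_trans (dkp _ (ltnW ipj)).
    rewrite /z' !phlo//; last exact: ltnW.
    by rewrite scale0r !addr0 divfK ?gt_eqF.
  have -> : z' i.+1 - z' i = z i.+1 - z i + j%:R^-1 *: w.
    by rewrite /z' opprD addrACA -scalerBl phS.
  by rewrite mulrAC ler_pdivlMr// ler_wpM2l.
have c01 i : (i < p + j)%N -> 0 <= varied_cost q p j z w i <= K * dl.
  move=> ipj; have di := dq _ (ltnW ipj); have hi := zs _ ipj.
  have kpi := dkp _ (ltnW ipj); have dzi : 0 < d (z i) by exact: lt_le_trans kpi.
  rewrite /varied_cost; case: ltnP => ip; rewrite divr_ge0 ?(ltW di) ?(ltW dzi)//=.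
    rewrite ler_pdivrMr//; apply: (le_trans hi); rewrite ler_wpM2r ?(ltW dzi)//.
    rewrite ler_peMl ?(ltW dl0)// /K.
    have : 0 <= 4 * q / (j%:R * dl * kp) by rewrite divr_ge0// !mulr_ge0// ltW.
    lra.
  rewrite ler_pdivrMr//; apply: (le_trans (ler_normD _ _)).
  rewrite normrZ_ge0 ?invr_ge0 ?(ltW j0')//.
  have -> : K * dl = 2 * dl + j%:R^-1 * (4 * q / kp).
    by rewrite /K; field; rewrite !gt_eqF.
  have w1 : j%:R^-1 * `|w| <= j%:R^-1 * (2 * q) by rewrite ler_wpM2l ?invr_ge0 ?(ltW j0').
  have w2 : 2 * q <= 4 * q / kp * (d (z i) - 2 * q).
    rewrite mulrAC ler_pdivlMr//; nra.
  have w3 : j%:R^-1 * (2 * q) <= j%:R^-1 * (4 * q / kp * (d (z i) - 2 * q)).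
    by rewrite ler_wpM2l ?invr_ge0 ?(ltW j0').
  rewrite mulrDl -[X in _ <= _ + X]mulrA.
  have : dl * d (z i) <= 2 * dl * (d (z i) - 2 * q) by nra.
  lra.
have [Oz kz] := chain_metric_le Omega_dom cz c01 Kdl.
rewrite z'E in Oz kz; split => //.
by rewrite -ler_pdivlMr// subr_gt0.
Qed.

Lemma sum_two_phases (A B : R) p j :
  \sum_(0 <= i < p + j) (if (i < p)%N then A else B) = p%:R * A + j%:R * B.
Proof.
rewrite (big_cat_nat (leq0n p) (leq_addr j p))/=; congr (_ + _).
  rewrite (eq_big_nat _ _ (F2 := fun=> A)); last by move=> i /andP[_ ->].
  by rewrite sumr_const_nat subn0 mulr_natl.
rewrite (eq_big_nat _ _ (F2 := fun=> B)); last first.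
  by move=> i /andP[pi _]; rewrite ltnNge pi.
by rewrite sumr_const_nat addKn mulr_natl.
Qed.

(** The weights [1 + al] and [1 - al] compensate the displacements
[(1 + al)^-1 *: h] and [- ((1 - al)^-1 *: h)]: for a step [v] the two weighted
lengths are the norms of [v + w] and [v - w], with [w] the sum of [al *: v] and the
increment of the displacement. So they are governed by the second difference of
the norm, without first order terms. *)
Lemma varied_cost_sum (dl q kp th e al : R) p j z h :
  0 < dl -> (0 < j)%N -> qh_chain (fun=> dl) (p + j) z ->
  (forall i, (i <= p + j)%N -> kp <= d (z i)) -> 0 < kp ->
  0 <= q -> `|h| <= q -> 4 * q <= kp -> `|al| <= 2^-1 -> 0 <= e ->
  `|al| + q / (j%:R * dl * kp) <= th ->
  (forall v w (r : R), 0 <= r -> `|v| <= r -> `|w| <= th * r ->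
     `|v + w| + `|v - w| <= 2 * r * (1 + e)) ->
  (1 + al) * (\sum_(0 <= i < p + j) varied_cost q p j z ((1 + al)^-1 *: h) i) +
  (1 - al) * (\sum_(0 <= i < p + j) varied_cost q p j z (- ((1 - al)^-1 *: h)) i)
  <= 2 * ((p + j)%N%:R * dl) + 2 * (j%:R * dl) * ((1 + e) * (1 + 4 * q / kp) - 1).
Proof.
move=> dl0 j0 [z0 zs] dkp kp0 q0 hq q4 al12 e0 hth smooth.
have j0' : (0 : R) < j%:R by rewrite ltr0n.
move: (al12); rewrite ler_norml => /andP[al1 al2].
have alp : 0 < 1 + al by lra.
have aln : 0 < 1 - al by lra.
rewrite !mulr_sumr -big_split/=.
apply: (@le_trans _ _ (\sum_(0 <= i < p + j)
    (if (i < p)%N then 2 * dl else 2 * dl * ((1 + e) * (1 + 4 * q / kp))))).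
  apply: ler_sum_nat => i /andP[_ ipj].
  have kpi := dkp _ (ltnW ipj); have dzi : 0 < d (z i) by exact: lt_le_trans kpi.
  have hi := zs _ ipj; rewrite /varied_cost; case: ltnP => ip.
    rewrite -mulrDl addrACA subrr addr0 -[1 + 1]/2 ler_wpM2l//.
    by rewrite ler_pdivrMr.
  have dq : 0 < d (z i) - 2 * q by lra.
  rewrite !mulrA -mulrDl ler_pdivrMr//.
  set v := z i.+1 - z i in hi *.
  pose w := al *: v + j%:R^-1 *: h.
  have -> : (1 + al) * `|v + j%:R^-1 *: ((1 + al)^-1 *: h)| = `|v + w|.
    rewrite -normrZ_ge0 ?(ltW alp)// scalerDr !scalerA.
    rewrite (_ : (1 + al) * (j%:R^-1 / (1 + al)) = j%:R^-1); last by field; rewrite !gt_eqF.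
    by rewrite scalerDl scale1r addrA.
  have -> : (1 - al) * `|v + j%:R^-1 *: - ((1 - al)^-1 *: h)| = `|v - w|.
    rewrite -normrZ_ge0 ?(ltW aln)// scalerN scalerBr !scalerA.
    rewrite (_ : (1 - al) / j%:R / (1 - al) = j%:R^-1); last by field; rewrite !gt_eqF.
    by rewrite scalerBl scale1r /w opprD addrA.
  have r0 : 0 <= dl * d (z i) by apply: mulr_ge0; exact: ltW.
  have wth : `|w| <= th * (dl * d (z i)).
    apply: le_trans (ler_wpM2r r0 hth).
    apply: (le_trans (ler_normD _ _)); rewrite mulrDl normrZ lerD ?ler_wpM2l//.
    rewrite normrZ_ge0 ?invr_ge0 ?(ltW j0')//.
    have -> : q / (j%:R * dl * kp) * (dl * d (z i)) = j%:R^-1 * (q * (d (z i) / kp)).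
      by field; rewrite !gt_eqF.
    rewrite ler_wpM2l ?invr_ge0 ?(ltW j0')//; apply: (le_trans hq).
    by rewrite ler_peMr// ler_pdivlMr// mul1r.
  apply: (le_trans (smooth _ _ _ r0 hi wth)).
  have dd : d (z i) <= (1 + 4 * q / kp) * (d (z i) - 2 * q).
    have -> : (1 + 4 * q / kp) * (d (z i) - 2 * q) =
       d (z i) + 2 * q * ((2 * d (z i) - 4 * q) / kp - 1) by field; rewrite gt_eqF.
    rewrite lerDl mulr_ge0// ?mulr_ge0// subr_ge0 ler_pdivlMr// mul1r; lra.
  have -> : 2 * (dl * d (z i)) * (1 + e) = 2 * dl * (1 + e) * d (z i) by ring.
  have c0 : 0 <= 2 * dl * (1 + e) by rewrite !mulr_ge0 ?(ltW dl0)// addr_ge0.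
  by apply: (le_trans (ler_wpM2l c0 dd)); rewrite le_eqVlt; apply/orP; left; apply/eqP; ring.
rewrite sum_two_phases natrD; lra.
Qed.

(** The first variation of k at [x] cancels in the weighted sum over the two
displaced points. What
remains is the second difference of the norm along a piece of length [s], together
with the first order change of d along that piece only. *)
Lemma metric_variation x h (al s r kp th e q : R) :
  Omega x -> k x <= r -> 0 < s -> s <= r -> `|al| <= 2^-1 ->
  0 < kp -> kp <= expR (- (2 * (r + 1))) * d 0 ->
  `|h| <= q -> 4 * q <= kp -> 0 <= e ->
  `|al| + q / (s * kp) <= th ->
  (forall v w (r : R), 0 <= r -> `|v| <= r -> `|w| <= th * r ->
     `|v + w| + `|v - w| <= 2 * r * (1 + e)) ->
  [/\ Omega (x + (1 + al)^-1 *: h), Omega (x - (1 - al)^-1 *: h) &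
  (1 + al) * k (x + (1 + al)^-1 *: h) + (1 - al) * k (x - (1 - al)^-1 *: h)
  <= 2 * r + 2 * s * ((1 + e) * (1 + 4 * q / kp) - 1)].
Proof.
move=> Ox kx s0 sr al12 kp0 kpd hq q4 e0 hth smooth.
have q0 : 0 <= q by exact: le_trans hq.
have [_ Ob _ _ _] := Omega_dom.
move: (al12); rewrite ler_norml => /andP[al1 al2].
have alp : 0 < 1 + al by lra.
have aln : 0 < 1 - al by lra.
set F := (1 + e) * _ - 1.
pose K := 2 + 4 * q / (s * kp).
have K0 : 0 <= K by rewrite addr_ge0// divr_ge0// !mulr_ge0// ltW.
have hp : `|(1 + al)^-1 *: h| <= 2 * q.
  rewrite normrZ_ge0 ?invr_ge0 ?(ltW alp)// ler_pdivrMl//.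
  by apply: (le_trans hq); nra.
have hn : `|- ((1 - al)^-1 *: h)| <= 2 * q.
  rewrite normrN normrZ_ge0 ?invr_ge0 ?(ltW aln)// ler_pdivrMl//.
  by apply: (le_trans hq); nra.
have main (c e' : R) : r < c -> c <= r + 1 -> 0 < e' ->
  [/\ Omega (x + (1 + al)^-1 *: h), Omega (x - (1 - al)^-1 *: h) &
  exists2 dl, 0 < dl < e' &
  ((1 + al) * k (x + (1 + al)^-1 *: h) + (1 - al) * k (x - (1 - al)^-1 *: h))
   * (1 - K * dl) <= 2 * c + 2 * s * F].
  move=> rc c1 e'0; have kc := le_lt_trans kx rc.
  have m0 : 0 < Num.min e' (Num.min 2^-1 (K + 1)^-1).
    by rewrite !lt_min e'0 invr_gt0 ltr0n invr_gt0 ltr_wpDl.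
  have [dl0 /andP[dl00]] := metric_reachable Omega_dom Ox kc m0.
  rewrite !le_min => /and3P[dle' dl2 dlK] hr.
  have [j j0 hj] := exists_natr_gt (s / dl0).
  have j0' : (0 : R) < j%:R by rewrite ltr0n.
  (* The varied piece of length s consists of exactly j steps of cost dl. *)
  pose dl := s / j%:R; have dlp : 0 < dl by rewrite divr_gt0.
  have dll : dl < dl0 by rewrite /dl ltr_pdivrMr// mulrC -ltr_pdivrMr.
  have jdl : j%:R * dl = s by rewrite /dl mulrC divfK// gt_eqF.
  have [m mdl rm] := hr _ dlp dll.
  have [p pdl [z cz zx]] : exists2 p, (p + j)%N%:R * dl <= c & reachable Omega dl (p + j) x.
    (* If the chain has fewer than j steps, it is padded with null steps; its cost
       is then s <= r. *)
    exists (m - j)%N.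
      have [jm|mj] := leqP j m; first by rewrite subnK.
      have -> : (m - j)%N = 0%N by apply/eqP; rewrite subn_eq0 ltnW.
      by rewrite add0n jdl; lra.
    by apply: reachable_leq rm _; [exact: ltW|rewrite addnC -maxnE leq_maxr].
  have dlh : dl <= 2^-1 by lra.
  have dkp i : (i <= p + j)%N -> kp <= d (z i).
    move=> ipj; apply: le_trans (chain_distance Omega_dom (ltW dlp) dlh cz ipj).
    apply: (le_trans kpd); rewrite ler_wpM2r ?boundary_distance_ge0// ler_expR lerN2.
    rewrite ler_wpM2l//; apply: le_trans c1; apply: le_trans pdl.
    by rewrite ler_wpM2r ?(ltW dlp)// ler_nat.
  have KE : 2 + 4 * q / (j%:R * dl * kp) = K by rewrite jdl.
  have Kdl : K * dl < 1.
    have K1 : 0 < K + 1 by rewrite ltr_wpDl.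
    have : dl * (K + 1) < 1 by rewrite -ltr_pdivlMr// mul1r (lt_le_trans dll).
    by lra.
  have Kdl' := Kdl; rewrite -KE in Kdl'.
  have [Op kxp] := chain_variation dlp j0 cz dkp kp0 q0 hp q4 Kdl'.
  have [On kxn] := chain_variation dlp j0 cz dkp kp0 q0 hn q4 Kdl'.
  rewrite zx KE in Op kxp On kxn; split => //.
  exists dl; first by rewrite dlp (lt_le_trans dll).
  have hth' : `|al| + q / (j%:R * dl * kp) <= th by rewrite jdl.
  have := varied_cost_sum dlp j0 cz dkp kp0 q0 hq q4 al12 e0 hth' smooth.
  rewrite -/F jdl => hsum.
  have h1 := ler_wpM2l (ltW alp) kxp; have h2 := ler_wpM2l (ltW aln) kxn.
  by rewrite mulrDl -!mulrA; lra.
have r0 : 0 < r by exact: lt_le_trans sr.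
have [|||Op On _] := main (r + 1) 1; rewrite ?ltrDl//.
split => //; apply/ler_addgt0Pr => e' e'0.
pose c := r + Num.min 1 (e' / 2).
have c0 : 0 < Num.min 1 (e' / 2) by rewrite lt_min ltr01 divr_gt0.
have c1 : c <= r + 1 by rewrite lerD2l ge_min lexx.
have ce : c <= r + e' / 2 by rewrite lerD2l ge_min lexx orbT.
have rc : r < c by rewrite ltrDl.
apply: (@le_trans _ _ (2 * c + 2 * s * F)); last by lra.
apply: (@le_of_small_factor _ _ _ K) => e'' e''0.
by have [_ _ [dl dle hS]] := main c e'' rc c1 e''0; exists dl.
Qed.

End Variation.

(** * Minkowski functionals of convex bodies *)

Section Minkowski.
Context {R : realType} {X : normedModType R}.
Variables (B : set X) (rho b : R).
Hypothesis B_convex : forall x y (l : R), 0 <= l <= 1 -> B x -> B y ->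
  B (l *: x + (1 - l) *: y).
Hypothesis B_opp : forall x, B x -> B (- x).
Hypothesis rho_gt0 : 0 < rho.
Hypothesis B_ball : forall x, `|x| <= rho -> B x.
Hypothesis b_gt0 : 0 < b.
Hypothesis B_bounded : forall x, B x -> `|x| <= b.
Implicit Types x y : X.

Local Notation M := (minkowski_functional B).

Lemma minkowski_le x (l : R) : 0 < l -> B (l^-1 *: x) -> M x <= l.
Proof.
move=> l0 Bx; apply: ge_inf; first by exists 0 => ? [/ltW].
split => //; exists (l^-1 *: x) => //.
by rewrite scalerA divff ?gt_eqF// scale1r.
Qed.

Lemma minkowski_gt x (l : R) : M x < l -> 0 < l /\ B (l^-1 *: x).
Proof.
move=> Ml.
have [l' [l'0 [y By xE]] l'l] : exists2 l', 0 < l' /\ [set l' *: y | y in B] x & l' < l.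
  apply: contrapT => nl; move: Ml; apply/negP; rewrite -leNgt.
  apply: lb_le_inf => [|l' El']; last first.
    by rewrite leNgt; apply/negP => l'l; apply: nl; exists l'.
  have p0 : 0 < `|x| / rho + 1 by rewrite ltr_wpDl// divr_ge0// ltW.
  exists (`|x| / rho + 1); split => //.
  exists ((`|x| / rho + 1)^-1 *: x); last by rewrite scalerA divff ?gt_eqF// scale1r.
  apply: B_ball; rewrite normrZ gtr0_norm ?invr_gt0// ler_pdivrMl//.
  by rewrite mulrDl divfK ?gt_eqF// mul1r lerDl ltW.
have l0 : 0 < l by exact: lt_trans l'l.
split => //.
have B0 : B 0 by apply: B_ball; rewrite normr0 ltW.
have h : 0 <= l^-1 * l' <= 1.
  by rewrite mulr_ge0 ?invr_ge0 ?(ltW l0) ?(ltW l'0)//= ler_pdivrMl// mulr1 ltW.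
by have := B_convex h By B0; rewrite scaler0 addr0 -scalerA xE.
Qed.

Lemma minkowski_ge0 x : 0 <= M x.
Proof.
rewrite leNgt; apply/negP => /minkowski_gt[]; by rewrite ltxx.
Qed.

Lemma minkowski_upper x : M x <= `|x| / rho.
Proof.
apply/ler_addgt0Pr => e e0.
have p0 : 0 < `|x| / rho + e by rewrite ltr_wpDl// divr_ge0// ltW.
apply: minkowski_le => //; apply: B_ball.
rewrite normrZ gtr0_norm ?invr_gt0// ler_pdivrMl//.
by rewrite mulrDl divfK ?gt_eqF// lerDl mulr_ge0// ltW.
Qed.

Lemma minkowski_lower x : `|x| <= b * M x.
Proof.
rewrite -ler_pdivrMl//; apply/ler_addgt0Pr => e e0.
have [l0 /B_bounded] := @minkowski_gt x (M x + e) ltac:(by rewrite ltrDl).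
rewrite normrZ gtr0_norm ?invr_gt0// ler_pdivrMl// => h.
by move: h; rewrite ler_pdivrMl// mulrC.
Qed.

Lemma minkowskiD x y : M (x + y) <= M x + M y.
Proof.
apply/ler_addgt0Pr => e e0.
have e2 : 0 < e / 2 by rewrite divr_gt0.
have [l0 Bx] := @minkowski_gt x (M x + e / 2) ltac:(by rewrite ltrDl).
have [l0' By] := @minkowski_gt y (M y + e / 2) ltac:(by rewrite ltrDl).
have -> : M x + M y + e = (M x + e / 2) + (M y + e / 2).
  by rewrite addrACA -splitr.
move: (M x + e / 2) (M y + e / 2) l0 Bx l0' By => l l' l0 Bx l0' By.
have ll : 0 < l + l' by rewrite addr_gt0.
apply: minkowski_le => //.
have l01 : 0 <= l / (l + l') <= 1.
  by rewrite divr_ge0 ?(ltW l0) ?(ltW ll)//= ler_pdivrMr// mul1r lerDl ltW.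
have := B_convex l01 Bx By; congr B.
rewrite !scalerA scalerDr; congr (_ *: _ + _ *: _); field; rewrite !gt_eqF//.
Qed.

Lemma minkowski_scale_le (a : R) x : M (a *: x) <= `|a| * M x.
Proof.
have [->|a0] := eqVneq a 0.
  by rewrite scale0r normr0 mul0r (le_trans (minkowski_upper _))// normr0 mul0r.
have na : 0 < `|a| by rewrite normr_gt0.
rewrite -ler_pdivrMl//; apply/ler_addgt0Pr => e e0.
have [l0 Bx] := @minkowski_gt x (M x + e) ltac:(by rewrite ltrDl).
rewrite ler_pdivrMl//; apply: minkowski_le; first by rewrite mulr_gt0.
rewrite scalerA invfM mulrAC.
have [ap|an] := ltP 0 a.
  by rewrite gtr0_norm// mulVf ?gt_eqF// mul1r.
rewrite ler0_norm// invrN mulNr mulVf// mulN1r scaleNr; exact: B_opp.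
Qed.

Lemma minkowskiZ (a : R) x : M (a *: x) = `|a| * M x.
Proof.
apply/eqP; rewrite eq_le minkowski_scale_le/=.
have [->|a0] := eqVneq a 0; first by rewrite normr0 mul0r minkowski_ge0.
have := minkowski_scale_le a^-1 (a *: x).
by rewrite scalerA mulVf// scale1r normfV ler_pdivlMl// normr_gt0.
Qed.

Lemma minkowski_equivalent_norm : equivalent_norm M.
Proof.
split; first split.
- exact: minkowskiD.
- exact: minkowskiZ.
- move=> x Mx; apply/eqP; rewrite -normr_le0.
  by have := minkowski_lower x; rewrite Mx mulr0.
exists b^-1, rho^-1; split; rewrite ?invr_gt0// => x.
by rewrite ler_pdivrMl// minkowski_lower mulrC minkowski_upper.
Qed.

End Minkowski.

(** * The norm induced by a quasihyperbolic ball *)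

Section QuasihyperbolicNorm.
Context {R : realType} {X : normedModType R}.
Variables (Omega : set X) (b r : R).
Hypothesis Omega_dom : symmetric_convex_domain Omega.
Hypothesis b_gt0 : 0 < b.
Hypothesis Omega_bounded : forall x, Omega x -> `|x| <= b.
Hypothesis r_gt0 : 0 < r.
Implicit Types x y h v w : X.

Local Notation d := (boundary_distance Omega).
Local Notation k := (quasihyperbolic_metric Omega 0).
Local Notation M := (quasihyperbolic_norm Omega r).
Local Notation mu := (modulus_of_smoothness (fun x : X => `|x|)).

Let rho := Num.min 2^-1 (r / 2) * d 0.

Let d0_gt0 : 0 < d 0.
Proof. by have [? ? ? _ _] := Omega_dom; exact: boundary_distance_gt0. Qed.

Let rho_gt0 : 0 < rho.
Proof. by rewrite mulr_gt0// lt_min invr_gt0 ltr0n divr_gt0. Qed.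

Local Notation B := (quasihyperbolic_ball Omega r).

Let B_convex x y (l : R) : 0 <= l <= 1 -> B x -> B y -> B (l *: x + (1 - l) *: y).
Proof.
move=> l01 [Ox kx] [Oy ky]; split; last exact: metric_convex.
by have [_ _ _ _ OC] := Omega_dom; exact: OC.
Qed.

Let B_opp x : B x -> B (- x).
Proof.
move=> [Ox kx]; split; last by apply: le_trans kx; exact: metric_opp.
by have [_ _ _ OV _] := Omega_dom; exact: OV.
Qed.

Let B_ball x : `|x| <= rho -> B x.
Proof. exact: metric_small. Qed.

Let B_bounded x : B x -> `|x| <= b.
Proof. by move=> [/Omega_bounded]. Qed.

Lemma qh_norm_equivalent : equivalent_norm M.
Proof.
exact: (minkowski_equivalent_norm B_convex B_opp rho_gt0 B_ball b_gt0 B_bounded).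
Qed.

Let M_norm : is_norm M.
Proof. by have [] := qh_norm_equivalent. Qed.

Let M_lower x : `|x| <= b * M x.
Proof. exact: (minkowski_lower B_convex rho_gt0 B_ball b_gt0 B_bounded). Qed.

Let M_upper x : M x <= `|x| / rho.
Proof. exact: (minkowski_upper rho_gt0 B_ball). Qed.

Lemma qh_norm_gt x (l : R) : M x < l -> 0 < l /\ B (l^-1 *: x).
Proof. exact: (minkowski_gt B_convex rho_gt0 B_ball). Qed.

(** Since k(l x) <= l k(x), the point [(r / c) *: x] lies in the ball of radius [r]. *)
Lemma qh_norm_le x (c : R) : Omega x -> k x <= c -> r <= c -> M x <= c / r.
Proof.
move=> Ox kx rc; have c0 : 0 < c by exact: lt_le_trans rc.
apply: minkowski_le; first by rewrite divr_gt0.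
rewrite invfM invrK mulrC.
have h : 0 <= r / c <= 1 by rewrite divr_ge0 ?(ltW r_gt0) ?(ltW c0)//= ler_pdivrMr// mul1r.
have [Oh kh] := metric_scale Omega_dom h Ox; split => //.
apply: (le_trans kh); rewrite mulrAC ler_pdivrMr//.
by rewrite ler_wpM2l// ltW.
Qed.

Lemma qh_norm_le_metric x : Omega x -> 1 < M x -> r * M x <= k x.
Proof.
move=> Ox M1; rewrite leNgt; apply/negP => kM.
have : M x <= Num.max r (k x) / r by apply: qh_norm_le; rewrite ?le_max ?lexx ?orbT.
rewrite ler_pdivlMr// leNgt gt_max mulrC kM andbT -[X in X < _]mulr1.
by rewrite ltr_pM2l// M1.
Qed.

(** With [al] the antisymmetric half of the increments of M at [y] and D the symmetric
half, the points (y + h) / (1 + al) and (y - h) / (1 - al) have norms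
1 + D / (1 + al) and 1 + D / (1 - al), and they are the two displaced points of a
variation of [y] in the direction h - al y. If D > 0, both have k at least [r]
times their norm, so the weighted sum of the values of k exceeds 2 r by at least
2 r D, while the variation bounds this excess. *)
Lemma qh_norm_second_difference y h (s t kp q th e : R) : B y -> `|h| <= t ->
  0 < s -> s <= r -> t / rho <= 2^-1 -> 0 < kp ->
  kp <= expR (- (2 * (r + 1))) * d 0 ->
  t * (1 + b / rho) <= q -> 4 * q <= kp -> 0 <= e -> t / rho + q / (s * kp) <= th ->
  (forall v w (r : R), 0 <= r -> `|v| <= r -> `|w| <= th * r ->
     `|v + w| + `|v - w| <= 2 * r * (1 + e)) ->
  M (y + h) + M (y - h) <= 2 + 2 * (s / r * ((1 + e) * (1 + 4 * q / kp) - 1)).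
Proof.
move=> [Oy ky] ht s0 sr tr kp0 kpd hq q4 e0 hth smooth.
have [MD MZ _] := M_norm.
set F := (1 + e) * _ - 1.
have t0 : 0 <= t by exact: le_trans ht.
have br0 : 0 < 1 + b / rho by rewrite addr_gt0// divr_gt0.
have q0 : 0 <= q by apply: le_trans hq; rewrite mulr_ge0// ltW.
have F0 : 0 <= F.
  have q' : 0 <= 4 * q / kp by rewrite divr_ge0 ?mulr_ge0// ltW.
  by rewrite /F; have := mulr_ge0 e0 q'; lra.
pose al := (M (y + h) - M (y - h)) / 2.
pose D := (M (y + h) + M (y - h)) / 2 - 1.
suff : D <= s / r * F by rewrite /D; lra.
have [D0|D0] := leP D 0.
  by apply: (le_trans D0); rewrite mulr_ge0// divr_ge0// ltW.
have alt : `|al| <= t / rho.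
  apply: (@le_trans _ _ (M h)); last first.
    by apply: (le_trans (M_upper _)); rewrite ler_wpM2r// invr_ge0 ltW.
  have h1 : M (y + h) <= M (y - h) + 2 * M h.
    have -> : y + h = (y - h) + (h + h) by rewrite addrA subrK.
    by apply: (le_trans (MD _ _)); have := MD h h; lra.
  have h2 : M (y - h) <= M (y + h) + 2 * M h.
    have -> : y - h = (y + h) + (- h - h) by rewrite addrA addrK.
    by apply: (le_trans (MD _ _)); have := MD (- h) (- h); rewrite (is_normN M_norm); lra.
  by rewrite ler_norml /al; lra.
have al12 : `|al| <= 2^-1 by exact: le_trans tr.
move: (al12); rewrite ler_norml => /andP[al1 al2].
have alp : 0 < 1 + al by lra.
have aln : 0 < 1 - al by lra.
pose h' := h - al *: y.
have hq' : `|h'| <= q.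
  apply: le_trans hq; apply: (le_trans (ler_normB _ _)).
  rewrite normrZ mulrDr mulr1 lerD// mulrCA [b * _]mulrC.
  by rewrite ler_pM// Omega_bounded.
have hth' : `|al| + q / (s * kp) <= th by apply: le_trans hth; rewrite lerD2r.
have [Op On] := metric_variation Omega_dom Oy ky s0 sr al12 kp0 kpd hq' q4 e0 hth' smooth.
have yp : y + (1 + al)^-1 *: h' = (1 + al)^-1 *: (y + h).
  apply: (scalerI (a := 1 + al)); first by rewrite gt_eqF.
  rewrite scalerDr !scalerA divff ?gt_eqF// !scale1r /h' scalerDl scale1r.
  by rewrite -addrA [al *: y + _]addrC subrK.
have yn : y - (1 - al)^-1 *: h' = (1 - al)^-1 *: (y - h).
  apply: (scalerI (a := 1 - al)); first by rewrite gt_eqF.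
  rewrite scalerBr !scalerA divff ?gt_eqF// !scale1r /h' scalerBl scale1r.
  by rewrite opprB addrA subrK.
rewrite yp yn in Op On *.
have Mp : (1 + al) * M ((1 + al)^-1 *: (y + h)) = 1 + al + D.
  rewrite MZ gtr0_norm ?invr_gt0// mulrA divff ?gt_eqF// mul1r /al /D; lra.
have Mn : (1 - al) * M ((1 - al)^-1 *: (y - h)) = 1 - al + D.
  rewrite MZ gtr0_norm ?invr_gt0// mulrA divff ?gt_eqF// mul1r /al /D; lra.
have Mp1 : 1 < M ((1 + al)^-1 *: (y + h)).
  by rewrite -(ltr_pM2l alp) Mp mulr1 ltrDl.
have Mn1 : 1 < M ((1 - al)^-1 *: (y - h)).
  by rewrite -(ltr_pM2l aln) Mn mulr1 ltrDl.
have kp' := ler_wpM2l (ltW alp) (qh_norm_le_metric Op Mp1).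
have kn' := ler_wpM2l (ltW aln) (qh_norm_le_metric On Mn1).
rewrite mulrCA Mp in kp'; rewrite mulrCA Mn in kn'.
rewrite -/F => hk; have -> : s / r * F = s * F / r by rewrite mulrAC.
by rewrite ler_pdivlMr//; lra.
Qed.

(** The length [s] of the varied piece remains free: a long piece makes the relative
change of the steps, [C * tau / s], small, and a short one makes the contribution
of d, of order [s * tau], small. *)
Lemma qh_modulus_le : (exists x : X, x != 0) ->
  exists2 C, 0 < C & forall tau s, 0 < tau -> 0 < s -> s <= 1 -> C * tau <= s -> s <= r ->
    modulus_of_smoothness M tau <= C * s * (mu (C * tau / s) + tau).
Proof.
move=> X0.
have [MD MZ _] := M_norm.
(* kp bounds d from below along chains of total cost at most r + 1. C1 * tau and C2 * tau bound
   al and the variation vector. *)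
pose kp := expR (- (2 * (r + 1))) * d 0.
have kp0 : 0 < kp by rewrite mulr_gt0// expR_gt0.
pose C1 := b / rho; pose C2 := b * (1 + b / rho).
have C1p : 0 < C1 by rewrite divr_gt0.
have C2p : 0 < C2 by rewrite mulr_gt0// addr_gt0// divr_gt0.
pose C0 := 2 * C1 + 8 * (C2 / kp).
have C2k : 0 < C2 / kp by rewrite divr_gt0.
have C0p : 0 < C0 by rewrite addr_gt0// mulr_gt0.
have ri : 0 < r^-1 by rewrite invr_gt0.
pose C := C0 + (C0 + 1) / r.
have CC0 : C0 <= C.
  by rewrite lerDl divr_ge0 ?(ltW r_gt0)// addr_ge0// ltW.
have Cp : 0 < C by exact: lt_le_trans CC0.
have C0r' : 0 < C0 / r by rewrite divr_gt0.
have CE : C = C0 + C0 / r + r^-1 by rewrite /C [(C0 + 1) / r]mulrDl mul1r addrA.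
have Cr : r^-1 <= C by rewrite CE; lra.
have C0r : C0 / r <= C by rewrite CE; lra.
exists C => // tau s tau0 s0 s1 Cts sr.
pose th := C * tau / s.
have th0 : 0 < th by rewrite divr_gt0// mulr_gt0.
have th1 : th <= 1 by rewrite ler_pdivrMr// mul1r.
have e0 : 0 <= mu th by exact: modulus_ge0 normr_is_norm _.
have e1 : mu th <= 1.
  by apply: le_trans th1; apply: modulus_le_tau normr_is_norm _ _; exact: ltW.
have C0ts : C0 * tau <= s by apply: le_trans Cts; rewrite ler_wpM2r// ltW.
pose t := b * tau; pose q := C2 * tau.
have t0 : 0 <= t by rewrite mulr_ge0// ltW.
have trE : t / rho = C1 * tau by rewrite /t /C1 mulrAC.
have qkE : q / kp = C2 / kp * tau by rewrite /q mulrAC.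
have C1t := mulr_gt0 C1p tau0; have C2t := mulr_gt0 C2k tau0.
have C0t : C0 * tau = 2 * (C1 * tau) + 8 * (C2 / kp * tau) by rewrite /C0; ring.
have tr : t / rho <= 2^-1 by rewrite trE; lra.
have q4 : 4 * q <= kp.
  have : q / kp <= 4^-1 by rewrite qkE; lra.
  by rewrite ler_pdivrMr//; lra.
have hth : t / rho + q / (s * kp) <= th.
  have -> : q / (s * kp) = q / kp / s by rewrite invfM mulrA mulrAC.
  rewrite /th ler_pdivlMr// mulrDl divfK ?gt_eqF// qkE trE.
  have : C1 * tau * s <= C1 * tau by rewrite ler_piMr// ltW.
  have : C0 * tau <= C * tau by rewrite ler_wpM2r// ltW.
  by lra.
have smooth := norm_sum_modulus X0.
have sm (v w : X) (r' : R) : 0 <= r' -> `|v| <= r' -> `|w| <= th * r' ->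
   `|v + w| + `|v - w| <= 2 * r' * (1 + mu th).
  by move=> r'0 vr wr; apply: smooth => //; exact: ltW.
apply: modulus_le.
  by rewrite mulr_ge0 ?addr_ge0 ?mulr_ge0 ?(ltW Cp) ?(ltW s0) ?(ltW tau0).
move=> y h My Mh.
apply: (@le_trans _ _ (2 + 2 * (s / r * ((1 + mu th) * (1 + 4 * q / kp) - 1)))); last first.
  rewrite lerD2l ler_wpM2l//.
  have -> : C * s * (mu (C * tau / s) + tau) = s * (C * mu th + C * tau) by rewrite -/th; ring.
  rewrite -mulrA ler_wpM2l ?(ltW s0)//.
  have qk0 : 0 <= q / kp by rewrite qkE ltW.
  have h1 : (1 + mu th) * (1 + 4 * q / kp) - 1 <= mu th + 8 * (q / kp).
    have -> : 4 * q / kp = 4 * (q / kp) by rewrite mulrA.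
    by have := mulr_ge0 qk0 (ltac:(by rewrite subr_ge0) : 0 <= 1 - mu th); lra.
  apply: (le_trans (ler_wpM2l (ltW ri) h1)); rewrite mulrDr lerD//.
    by rewrite ler_wpM2r.
  apply: (@le_trans _ _ (C0 / r * tau)); last by rewrite ler_wpM2r// ltW.
  have -> : C0 / r * tau = r^-1 * (C0 * tau) by ring.
  by rewrite ler_wpM2l ?(ltW ri)// qkE C0t; lra.
apply/ler_addgt0Pr => e e'0.
set A := 2 + _.
have A0 : 0 < A.
  rewrite ltr_pwDl// mulr_ge0// mulr_ge0 ?divr_ge0 ?(ltW s0) ?(ltW r_gt0)//.
  have qk0 : 0 <= 4 * q / kp by rewrite -mulrA qkE mulr_ge0// ltW.
  by have := mulr_ge0 e0 qk0; lra.
(* A vector of norm 1 is only known to lie in the ball after division by some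
   l > 1; then l tends to 1. *)
pose l := 1 + e / A.
have l1 : 1 < l by rewrite ltrDl divr_gt0.
have l0 : 0 < l by lra.
have By : B (l^-1 *: y).
  apply: (minkowski_gt B_convex rho_gt0 B_ball _).2.
  by rewrite -[minkowski_functional _ _]/(M y) My.
have ht : `|l^-1 *: h| <= t.
  rewrite normrZ gtr0_norm ?invr_gt0// ler_pdivrMl//.
  apply: (le_trans (M_lower _)); rewrite Mh -/t.
  by rewrite ler_peMl// ltW.
have := qh_norm_second_difference By ht s0 sr tr kp0 (lexx _) _ q4 e0 hth sm.
rewrite -/A -scalerDr -scalerBr !MZ gtr0_norm ?invr_gt0// -mulrDr.
rewrite ler_pdivrMl// /l mulrDl mul1r divfK ?gt_eqF// => -> //.
by rewrite /t /q /C2 mulrAC.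
Qed.

End QuasihyperbolicNorm.

(** * Rates, and the unit ball of an equivalent norm *)

Section Asymptotics.
Context {R : realType}.

Lemma near_0_right (P : R -> Prop) : (\forall t \near 0^'+, P t) <->
  exists2 t0, 0 < t0 & forall t, 0 < t -> t < t0 -> P t.
Proof.
split=> [|[t0 t00 h]].
  rewrite near_withinE => /nbhs_ballP[e /= e0 he]; exists e => // t tp te.
  by apply: he => //; rewrite -ball_normE /= sub0r normrN gtr0_norm.
near=> t; apply: h; first by near: t; exact: nbhs_right_gt.
by near: t; exact: nbhs_right_lt.
Unshelve. all: by end_near. Qed.

Variables (f g : R -> R) (C r : R).
Hypothesis C_gt0 : 0 < C.
Hypothesis r_gt0 : 0 < r.
Hypothesis g_ge0 : forall tau, 0 <= g tau.
Hypothesis gf : forall tau s, 0 < tau -> 0 < s -> s <= 1 -> C * tau <= s -> s <= r ->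
  g tau <= C * s * (f (C * tau / s) + tau).

(** For [s] fixed, the first term is o(tau), and the second one is [C * s * tau] with
[s] arbitrarily small. *)
Lemma smooth_transfer :
  f tau / tau @[tau --> 0^'+] --> (0 : R) -> g tau / tau @[tau --> 0^'+] --> (0 : R).
Proof.
move=> /cvgrPdist_lt hf; apply/cvgrPdist_lt => e e0.
have C2 : 0 < 4 * (C * C) by rewrite !mulr_gt0.
have /hf/near_0_right[t0 t00 ht0] : 0 < e / (4 * (C * C)) by rewrite divr_gt0.
pose s := Num.min (Num.min 1 r) (e / (4 * C)).
have C4 : 0 < 4 * C by rewrite mulr_gt0.
have s0 : 0 < s by rewrite !lt_min ltr01 r_gt0 divr_gt0.
have s1 : s <= 1 by rewrite !ge_min lexx.
have sr : s <= r by rewrite !ge_min lexx orbT.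
have se : s <= e / (4 * C) by rewrite ge_min lexx orbT.
apply/near_0_right; exists (Num.min s (s * t0) / C).
  by rewrite divr_gt0// lt_min s0 mulr_gt0.
move=> tau tau0; rewrite ltr_pdivlMr// lt_min => /andP[h1 h2].
rewrite sub0r normrN ger0_norm; last by rewrite divr_ge0// ltW.
have Cts : C * tau <= s by rewrite mulrC ltW.
rewrite ltr_pdivrMr//; apply: (le_lt_trans (gf tau0 s0 s1 Cts sr)).
set th := C * tau / s.
have th0 : 0 < th by rewrite divr_gt0// mulr_gt0.
have tht0 : th < t0 by rewrite ltr_pdivrMr// mulrC [t0 * _]mulrC.
have := ht0 _ th0 tht0; rewrite sub0r normrN => /(le_lt_trans (ler_norm _)).
rewrite ltr_pdivrMr// => fth.
have Cs : 0 < C * s by rewrite mulr_gt0.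
have -> : e * tau = C * s * (e / (4 * (C * C)) * th) * 4.
  by rewrite /th; field; rewrite !gt_eqF.
have h3 : C * s * tau <= C * s * (e / (4 * (C * C)) * th).
  have -> : C * s * (e / (4 * (C * C)) * th) = (e / (4 * C)) * (C * tau).
    by rewrite /th; field; rewrite !gt_eqF.
  by rewrite mulrC mulrA [tau * C]mulrC [X in _ <= X]mulrC ler_wpM2l// mulr_ge0// ltW.
have h4 := ler_wpM2l (ltW Cs) (ltW fth).
have h5 : 0 < C * s * (e / (4 * (C * C)) * th) by rewrite !mulr_gt0// invr_gt0.
rewrite mulrDr; lra.
Qed.

(** With [s] the square root of [tau], the two terms are of orders
tau^(1/2 + p/2) and tau^(3/2), and p <= 2. *)
Lemma power_transfer (p q K : R) : 1 < p -> p <= 2 -> q < (p + 1) / 2 ->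
  (\forall tau \near 0^'+, f tau <= K * tau `^ p) ->
  exists K', \forall tau \near 0^'+, g tau <= K' * tau `^ q.
Proof.
move=> p1 p2 qp /near_0_right[t0 t00 ht0].
exists (C * (`|K| * C `^ p + 1)).
(* The square root of tau has to be below 1, r, 1 / C, so that C tau <= sqrt tau,
   and t0 / C, so that the bound on f applies at C tau / sqrt tau = C sqrt tau. *)
pose s0 := Num.min (Num.min 1 r) (Num.min C^-1 (t0 / C)).
have s00 : 0 < s0 by rewrite !lt_min ltr01 r_gt0 invr_gt0 C_gt0 divr_gt0.
apply/near_0_right; exists (Num.min 1 (s0 ^+ 2)).
  by rewrite lt_min ltr01 exprn_gt0.
move=> tau tau0; rewrite lt_min => /andP[/ltW tau1 taus].
pose s := tau `^ 2^-1.
have sp : 0 < s by exact: powR_gt0.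
have ss : s * s = tau.
  have half : 2^-1 + 2^-1 = 1 :> R by lra.
  by rewrite -powRD ?(gt_eqF tau0) ?implybT// half powRr1 ?(ltW tau0).
have s_s0 : s < s0.
  by rewrite -(@ltr_pXn2r _ 2)// ?nnegrE ?(ltW sp) ?(ltW s00)// expr2 ss.
move: s_s0; rewrite !lt_min => /andP[/andP[/ltW s1 /ltW sr] /andP[sC st]].
have Cs1 : C * s <= 1 by rewrite -ler_pdivlMl// mulr1 ltW.
have Cts : C * tau <= s by rewrite -ss mulrA ler_piMl// ltW.
apply: (le_trans (gf tau0 sp s1 Cts sr)).
have -> : C * tau / s = C * s by rewrite -ss; field; rewrite gt_eqF.
have Cs0 : 0 < C * s by rewrite mulr_gt0.
have Cst : C * s < t0 by rewrite mulrC -ltr_pdivlMr.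
have sq : s * s `^ p <= tau `^ q.
  rewrite /s -powRrM -powRD ?(gt_eqF tau0) ?implybT//.
  by apply: ger_powR; [rewrite tau0|lra].
have tq : s * tau <= tau `^ q.
  rewrite -[X in s * X]powRr1 ?(ltW tau0)// -powRD ?(gt_eqF tau0) ?implybT//.
  by apply: ger_powR; [rewrite tau0|lra].
have fle : f (C * s) <= `|K| * C `^ p * s `^ p.
  apply: (le_trans (ht0 _ Cs0 Cst)).
  rewrite powRM ?(ltW C_gt0) ?(ltW sp)// -mulrA ler_wpM2r ?ler_norm//.
  by rewrite mulr_ge0 ?powR_ge0.
rewrite -!mulrA ler_wpM2l ?(ltW C_gt0)//.
have KC : 0 <= `|K| * C `^ p by rewrite mulr_ge0 ?powR_ge0.
have := ler_wpM2l (ltW sp) fle; have := ler_wpM2l KC sq.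
rewrite mulrDr mulrDl; lra.
Qed.

End Asymptotics.

Section NormBall.
Context {R : realType} {X : normedModType R}.
Variable N : X -> R.
Variables c C : R.
Hypothesis N_norm : is_norm N.
Hypothesis c_gt0 : 0 < c.
Hypothesis C_gt0 : 0 < C.
Hypothesis N_bounds : forall x, c * `|x| <= N x <= C * `|x|.
Hypothesis X_neq0 : exists x : X, x != 0.
Implicit Types x y : X.

Definition norm_ball : set X := [set x | N x < 1].

Let N_upper x : N x <= C * `|x|.
Proof. by have /andP[] := N_bounds x. Qed.

Let N_ge0 x : 0 <= N x.
Proof. by have /andP[+ _] := N_bounds x; apply: le_trans; rewrite mulr_ge0// ltW. Qed.

Let N_scale_ge0 (a : R) x : 0 <= a -> N (a *: x) = a * N x.
Proof. by have [_ NZ _] := N_norm; move=> a0; rewrite NZ ger0_norm. Qed.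

Let ND x y : N (x + y) <= N x + N y.
Proof. by have [h _ _] := N_norm. Qed.

Lemma norm_ball_bounded x : norm_ball x -> `|x| <= c^-1.
Proof.
rewrite /norm_ball/= => Nx; have /andP[h _] := N_bounds x.
by rewrite -[c^-1]mulr1 ler_pdivlMl//; lra.
Qed.

Lemma norm_ball_ball x v : `|v| < (1 - N x) / C -> norm_ball (x + v).
Proof.
rewrite ltr_pdivlMr// mulrC /norm_ball/= => h.
by have := ND x v; have := N_upper v; lra.
Qed.

Lemma norm_ball_open : open norm_ball.
Proof.
rewrite openE => x; rewrite /norm_ball/= => Nx; apply/nbhs_ballP.
exists ((1 - N x) / C) => /=; first by rewrite divr_gt0// subr_gt0.
move=> y; rewrite -ball_normE/= => xy.
by rewrite -[y](subrK x) addrC; apply: norm_ball_ball; rewrite distrC.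
Qed.

Lemma norm_ball_boundary : boundary norm_ball !=set0.
Proof.
have [x x0] := X_neq0.
have Nx : 0 < N x.
  have /andP[h _] := N_bounds x; apply: lt_le_trans h.
  by rewrite mulr_gt0// normr_gt0.
pose w := (N x)^-1 *: x.
have Nw : N w = 1 by rewrite N_scale_ge0 ?invr_ge0// mulVf// gt_eqF.
exists w; split; last first.
  by move=> /interior_subset; rewrite /norm_ball/= Nw ltxx.
move=> B /nbhs_ballP[e /= e0 eB].
have w1 : 0 < `|w| + 1 by rewrite ltr_wpDl.
pose l := Num.min 1 (e / (`|w| + 1)).
have l0 : 0 < l by rewrite lt_min ltr01 divr_gt0.
have l1 : l <= 1 by rewrite ge_min lexx.
have le : l <= e / (`|w| + 1) by rewrite ge_min lexx orbT.
exists ((1 - l) *: w); split.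
  by rewrite /norm_ball/= N_scale_ge0 ?subr_ge0// Nw mulr1 gtrDl oppr_lt0.
apply: eB; rewrite -ball_normE/= -[X in X - _]scale1r -scalerBl opprB addrCA subrr addr0.
rewrite normrZ_ge0 ?(ltW l0)//.
by rewrite ler_pdivlMr// in le; apply: lt_le_trans le; rewrite ltr_pM2l// ltrDl.
Qed.

Lemma norm_ball_convex x y (l : R) : 0 <= l <= 1 -> norm_ball x -> norm_ball y ->
  norm_ball (l *: x + (1 - l) *: y).
Proof.
move=> /andP[l0 l1]; rewrite /norm_ball/= => Nx Ny.
apply: (le_lt_trans (ND _ _)); rewrite !N_scale_ge0 ?subr_ge0//.
have h : (1 - l) * N y <= 1 - l by rewrite ler_piMr ?subr_ge0// ltW.
have [lp|ln] := ltP 0 l; first by have := ltr_pM2l lp (N x) 1; rewrite Nx mulr1; lra.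
have -> : l = 0 by lra.
by rewrite mul0r add0r subr0 mul1r.
Qed.

Lemma norm_ball_opp x : norm_ball x -> norm_ball (- x).
Proof. by rewrite /norm_ball/= (is_normN N_norm). Qed.

Lemma norm_ball0 : norm_ball 0.
Proof.
rewrite /norm_ball/=; apply: le_lt_trans ltr01.
by have := N_upper 0; rewrite normr0 mulr0.
Qed.

Lemma norm_ball_symmetric_convex : symmetric_convex_domain norm_ball.
Proof.
split; [exact: norm_ball_open|exact: norm_ball_boundary|exact: norm_ball0|
  exact: norm_ball_opp|exact: norm_ball_convex].
Qed.

Lemma norm_ball_is_domain : [/\ domain norm_ball,
  convex_set (norm_ball : set (convex_lmodType X)), bounded_set norm_ball
  & symmetric_set norm_ball].
Proof.
split.
- split; [exact: norm_ball_open| |exact: norm_ball_boundary].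
  move=> x y Bx By; exists (fun t : R => t *: y + (1 - t) *: x).
  have [] := @lipschitz_curve_in _ _ norm_ball `|y - x|
    (fun t : R => t *: y + (1 - t) *: x) (normr_ge0 _).
  + by move=> t t01; apply: norm_ball_convex.
  + move=> s t s0 st t1; rewrite opprD addrACA -!scalerBl.
    have -> : 1 - t - (1 - s) = - (t - s) by ring.
    by rewrite scaleNr -scalerBr normrZ_ge0 ?subr_ge0// mulrC.
  by rewrite !scale0r !scale1r subr0 subrr scale0r add0r addr0 scale1r.
- move=> x y l; rewrite !inE => Bx By.
  by apply: norm_ball_convex => //; rewrite ge0 le1.
- exists c^-1; split; first by rewrite num_real.
  by move=> M cM x Bx; apply: le_trans (ltW cM); exact: norm_ball_bounded.
- rewrite /symmetric_set predeqE => x; split=> [[y By <-]|Bx]; first exact: norm_ball_opp.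
  by exists (- x); [exact: norm_ball_opp|rewrite opprK].
Qed.

Lemma norm_ball_distance x : norm_ball x ->
  (1 - N x) / C <= boundary_distance norm_ball x.
Proof.
move=> Bx; apply: boundary_distance_ge_ball; [exact: norm_ball_open|
  exact: norm_ball_boundary|exact: norm_ball_ball].
Qed.

(** On the segment from 0 to [x] the distance to the boundary is at least [e / C]. *)
Lemma norm_ball_metric x (e : R) : 0 < e -> N x <= 1 - e ->
  norm_ball x /\
  quasihyperbolic_metric norm_ball 0 x <= 2 * (C / (c * e)).
Proof.
move=> e0 Nx.
have Bx : norm_ball x by rewrite /norm_ball/=; lra.
split => //.
have a0 : 0 < e / C by rewrite divr_gt0.
have ad : e / C <= boundary_distance norm_ball x.
  by apply: le_trans (norm_ball_distance Bx); rewrite ler_wpM2r ?invr_ge0 ?(ltW C_gt0)//; lra.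
have [n n0 hn] := exists_natr_gt (2 * (`|x| / (e / C))).
have n0' : (0 : R) < n%:R by rewrite ltr0n.
have rx := straight_reachable norm_ball_symmetric_convex n0 a0 Bx ad.
set dl := _ / n%:R in rx.
have dl0 : 0 <= dl by rewrite !divr_ge0// ltW.
have dl2 : dl <= 2^-1 by rewrite ler_pdivrMr//; lra.
have [|_ kx] := reachable_metric_le norm_ball_symmetric_convex dl0 _ rx; first by lra.
apply: (le_trans kx).
have -> : n%:R * dl = `|x| / (e / C) by rewrite /dl mulrC divfK// gt_eqF.
rewrite ler_pdivrMr; last by lra.
have h : `|x| / (e / C) <= C / (c * e).
  have -> : C / (c * e) = c^-1 / (e / C) by field; rewrite !gt_eqF.
  by rewrite ler_wpM2r ?invr_ge0 ?(ltW a0)// norm_ball_bounded.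
have p0 : 0 <= C / (c * e) by rewrite divr_ge0 ?mulr_ge0// ltW.
apply: (le_trans h); nra.
Qed.

Lemma qh_norm_norm_ball_ge (r : R) x : 0 < r ->
  N x <= quasihyperbolic_norm norm_ball r x.
Proof.
move=> r0; apply/ler_addgt0Pr => e e0; set l := _ + e.
have [l0 [+ _]] := @qh_norm_gt _ _ _ _ norm_ball_symmetric_convex r0 x l
  ltac:(by rewrite ltrDl).
rewrite /norm_ball/= N_scale_ge0 ?invr_ge0 ?(ltW l0)// ltr_pdivrMl// mulr1.
exact: ltW.
Qed.

Lemma qh_norm_norm_ball_le (e : R) x : 0 < e -> e < 1 ->
  quasihyperbolic_norm norm_ball (2 * (C / (c * e))) x <= N x / (1 - e).
Proof.
move=> e0 e1; have e1' : 0 < 1 - e by rewrite subr_gt0.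
apply/ler_addgt0Pr => a a0; set l := _ + a.
have l0 : 0 < l by rewrite ltr_wpDl// divr_ge0// ltW.
apply: minkowski_le => //; apply: norm_ball_metric => //.
rewrite N_scale_ge0 ?invr_ge0 ?(ltW l0)// ler_pdivrMl//.
by rewrite mulrDl divfK ?gt_eqF// lerDl mulr_ge0// ltW.
Qed.

Lemma qh_norm_approximation (e : R) x : 0 < e -> e <= 2^-1 ->
  `|quasihyperbolic_norm norm_ball (2 * (C / (c * e))) x - N x| <= 2 * e * (C * `|x|).
Proof.
move=> e0 e2; have e1 : e < 1 by lra.
have r0 : 0 < 2 * (C / (c * e)) by rewrite mulr_gt0// divr_gt0// mulr_gt0.
have lo := qh_norm_norm_ball_ge x r0; have hi := qh_norm_norm_ball_le x e0 e1.
rewrite ger0_norm ?subr_ge0//.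
have Nx := N_ge0 x.
have h : N x / (1 - e) <= N x + 2 * e * N x.
  rewrite ler_pdivrMr ?subr_gt0//.
  have -> : (N x + 2 * e * N x) * (1 - e) = N x + N x * e * (1 - 2 * e) by ring.
  by rewrite lerDl !mulr_ge0 ?(ltW e0)//; lra.
have : 2 * e * N x <= 2 * e * (C * `|x|) by rewrite ler_wpM2l// mulr_ge0// ltW.
lra.
Qed.

End NormBall.

Theorem theorem4p2 (R : realType) (X : completeNormedModType R)
    (X_neq0 : exists x : X, x != 0)
    (X_smooth : uniformly_smooth (fun x : X => `|x|))
    (N : X -> R) (N_equiv : equivalent_norm N)
    (S : set X) (S_bounded : bounded_set S)
    (eps : R) (eps_gt0 : 0 < eps) :
  exists (Omega : set X) (r : R),
    [/\ [/\ domain Omega, convex_set (Omega : set (convex_lmodType X)),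
            bounded_set Omega & symmetric_set Omega],
        0 < r,
        equivalent_norm (quasihyperbolic_norm Omega r) /\
          uniformly_smooth (quasihyperbolic_norm Omega r),
        (ereal_sup [set `|quasihyperbolic_norm Omega r x - N x|%:E | x in S]
           <= eps%:E)%E
      & forall p : R, 1 < p -> p <= 2 ->
          smoothness_power_type (fun x : X => `|x|) p ->
          forall q : R, q < (p + 1) / 2 ->
            smoothness_power_type (quasihyperbolic_norm Omega r) q].
Proof.
have [N_norm [c [C [c0 C0 N_bounds]]]] := N_equiv.
have [b b0 Sb] := pinfty_ex_gt0 S_bounded.
(* The error of approximation on the ball of radius b is at most 2 e C b. *)
pose e := Num.min 2^-1 (eps / (2 * (C * b))).
have Cb : 0 < C * b by rewrite mulr_gt0.
have e0 : 0 < e by rewrite lt_min invr_gt0 ltr0n divr_gt0// mulr_gt0.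
have e2 : e <= 2^-1 by rewrite ge_min lexx.
have e_eps : e <= eps / (2 * (C * b)) by rewrite ge_min lexx orbT.
pose r := 2 * (C / (c * e)).
have r0 : 0 < r by rewrite mulr_gt0// divr_gt0// mulr_gt0.
have dom := norm_ball_symmetric_convex N_norm c0 C0 N_bounds X_neq0.
have bnd := norm_ball_bounded c0 N_bounds.
have ci0 : 0 < c^-1 by rewrite invr_gt0.
have equiv := qh_norm_equivalent dom ci0 bnd r0.
have mu0 := modulus_ge0 equiv.1.
have [K K0 transfer] := qh_modulus_le dom ci0 bnd r0 X_neq0.
exists (norm_ball N), r; split => //.
- exact: (norm_ball_is_domain N_norm c0 C0 N_bounds X_neq0).
- by split => //; exact: (smooth_transfer K0 r0 mu0 transfer).
- apply: ge_ereal_sup => _ [x Sx <-]; rewrite lee_fin.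
  apply: (le_trans (qh_norm_approximation N_norm c0 C0 N_bounds X_neq0 x e0 e2)).
  have xb := Sb x Sx.
  apply: (@le_trans _ _ (2 * e * (C * b))).
    by rewrite ler_wpM2l ?mulr_ge0 ?(ltW e0)// ler_wpM2l// ltW.
  rewrite ler_pdivlMr in e_eps; last by rewrite mulr_gt0.
  by lra.
- move=> p p1 p2 [L hL] q qp.
  exact: (power_transfer K0 r0 transfer p1 p2 qp hL).
Qed.
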